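(* Let $M\subset \mathbf{P}^m$ be a complex projective variety and let $n$ be a natural number. Let $D_1,\dots,D_{2n+1}$ be divisors on $M$, i.e. $D_j=H_j\cap M$ with $H_j$ a hyperplane in $\mathbf{P}^m$, such that any $n+1$ of them have empty intersection: $\bigcap_{j\in I}D_j=\emptyset$ for every $I\subset\{1,\dots,2n+1\}$ with $\operatorname{card} I=n+1$. Then every holomorphic map $f:\mathbf{C}\to M$ that omits all of these divisors, i.e. $f(\mathbf{C})\cap D_j=\emptyset$ for $j=1,\dots,2n+1$, is constant.
   Context: $\mathbf{P}^m$ is complex projective space of dimension $m$. A projective variety $M\subset\mathbf{P}^m$ is a Zariski closed subset. By a divisor on $M$ we mean the set-theoretic intersection of a hyperplane in $\mathbf{P}^m$ with $M$. A holomorphic map $f:\mathbf{C}\to M$ is a holomorphic map $\mathbf{C}\to\mathbf{P}^m$ whose image lies in $M$. No relation between $n$ and the dimension of $M$ is assumed. *)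

(* Defs.v *)
From mathcomp Require Import all_boot all_order all_algebra.
From mathcomp Require Import all_classical all_reals all_analysis.
From mathcomp Require Import complex.
(* The notations of mpoly clash with those of MathComp-Analysis. *)
From mathcomp Require Import -(notations) mpoly.

Set Implicit Arguments.
Unset Strict Implicit.
Unset Printing Implicit Defensive.

Import Order.TTheory GRing.Theory Num.Theory.
Import numFieldNormedType.Exports.

Local Open Scope classical_set_scope.
Local Open Scope complex_scope.
Local Open Scope ring_scope.

(* P^m(F): the lines through the origin of F^(m+1). *)
Definition projective_space (F : fieldType) (m : nat) :=
  {L : {vspace 'rV[F]_m.+1} | \dim L == 1}.

Section ProjectiveGeometry.
Variables (F : fieldType) (m : nat).
Implicit Types (x : projective_space F m) (p : mpoly m.+1 F).

(* Meaningful for homogeneous p only. The vector 0 is harmless: it is a zero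
   of every homogeneous p, except nonzero constants, which have no zero. *)
Definition vanishes_at p x :=
  forall v : 'rV[F]_m.+1, v \in val x -> meval (fun i => v 0 i) p = 0.

Definition zariski_closed (M : set (projective_space F m)) :=
  exists S : set (mpoly m.+1 F),
    (forall p, S p -> exists d, p \is @ishomog1 m.+1 F d mdeg) /\
    M = [set x | forall p, S p -> vanishes_at p x].

Definition hyperplane (H : set (projective_space F m)) :=
  exists2 a : 'rV[F]_m.+1, a != 0 &
    H = [set x : projective_space F m | forall v : 'rV[F]_m.+1, v \in val x ->
                   \sum_i a 0 i * v 0 i = 0].

Definition divisor_on (M D : set (projective_space F m)) :=
  exists2 H, hyperplane H & D = H `&` M.

(* An arbitrary nonzero vector of the line x; affine_chartE and affine_coordE
   show that its choice is irrelevant. *)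
Definition homogeneous_coords x : 'rV[F]_m.+1 := vpick (val x).

Definition affine_chart (i : 'I_m.+1) : set (projective_space F m) :=
  [set x | homogeneous_coords x 0 i != 0].

Definition affine_coord (i k : 'I_m.+1) x : F :=
  homogeneous_coords x 0 k / homogeneous_coords x 0 i.

Lemma homogeneous_coordsP x (v : 'rV[F]_m.+1) :
  v \in val x -> v != 0 -> exists2 c, c != 0 & v = c *: homogeneous_coords x.
Proof.
rewrite /homogeneous_coords; case: x => L /= dimL vL v0.
have w0 : vpick L != 0 by rewrite vpick0 -dimv_eq0 (eqP dimL).
have LE : (<[vpick L]> == L)%VS.
  by rewrite eqEdim -memvE memv_pick dim_vline w0 (eqP dimL).
move: vL; rewrite -{1}(eqP LE) => /vlineP[c vE].
by exists c => //; apply: contraNneq v0 => c0; rewrite vE c0 scale0r.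
Qed.

Lemma affine_chartE i x (v : 'rV[F]_m.+1) :
  v \in val x -> v != 0 -> affine_chart i x <-> v 0 i != 0.
Proof.
move=> vx v0; have [c c0 ->] := homogeneous_coordsP vx v0.
by rewrite /affine_chart /= mxE mulf_eq0 (negbTE c0).
Qed.

Lemma affine_coordE i k x (v : 'rV[F]_m.+1) :
  v \in val x -> v != 0 -> affine_coord i k x = v 0 k / v 0 i.
Proof.
move=> vx v0; have [c c0 ->] := homogeneous_coordsP vx v0.
by rewrite /affine_coord !mxE -mulf_div divff// mul1r.
Qed.

End ProjectiveGeometry.

(* Holomorphy for the complex manifold structure of P^m given by its standard
   affine charts: if f z0 lies in a chart, then so does f z for z near z0, and
   the affine coordinates of f are complex differentiable there. The alias
   R[i]^o carries the structure of normed space of R[i] over itself. *)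
Definition holomorphic_curve (R : realType) (m : nat)
    (f : R[i] -> projective_space R[i] m) :=
  forall (z0 : R[i]) (i : 'I_m.+1), affine_chart i (f z0) ->
    \forall z \near (z0 : R[i]^o),
      affine_chart i (f z) /\
      forall k : 'I_m.+1,
        derivable (affine_coord i k \o f : R[i]^o -> R[i]^o) z 1.

(* Main.v *)
Require Import Defs.
From mathcomp Require Import all_boot all_order all_algebra.
From mathcomp Require Import all_classical all_reals all_analysis.
From mathcomp Require Import complex.
From mathcomp Require Import -(notations) mpoly.
From mathcomp Require Import ring lra zify.

(* Dividing homogeneous coordinates of f by one of the omitted linear forms
   turns the forms L_j(f) into nowhere vanishing entire functions, one of which
   is 1. The functions u_j = log |L_j(f)| are then harmonic, and compactness of
   M bounds max_j u_j - max_(j in I) u_j for every I of cardinal n+1: at every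
   point at least n+1 of the 2n+1 functions u_j are maximal up to a constant C.

   If no difference max_j u_j - u_k were bounded, one could rescale (as in the
   proofs of Picard's theorem by Lewis and Eremenko) at a disc on which the
   smallest of these differences is large and nearly extremal, and divide by its
   size. Harnack's inequality then bounds the rescaled functions from above, and
   C becomes arbitrarily small. Two rescaled functions which are both almost
   maximal on a common small disc are close on the whole disc, so at some point
   all almost maximal functions are close to each other. They form a majority
   of the functions; hence at every other point of the disc one of them is
   almost maximal, so that each of them is almost maximal on the whole disc, a
   contradiction. Hence some max_j u_j - u_k is bounded, and Liouville's theorem
   makes all the u_j, and then f, constant.

   Holomorphy is only complex differentiability here. Integrals are replaced by
   Riemann sums over dyadic roots of unity: sums over the boundary of a square
   are exactly additive under subdivision, so bisection gives Goursat's theorem,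
   Cauchy's formula and Taylor expansions. *)

Set Implicit Arguments.
Unset Strict Implicit.
Unset Printing Implicit Defensive.

Import Order.TTheory GRing.Theory Num.Theory.
Import numFieldNormedType.Exports.
Import ComplexField.Normc.

Local Open Scope classical_set_scope.
Local Open Scope complex_scope.
Local Open Scope ring_scope.

(* MathComp's algebraic Re and Im return complex numbers. *)
Local Notation Re := complex.Re.
Local Notation Im := complex.Im.

(** * Modulus and complex derivative *)

(** The maximum of the u_j is only subharmonic, so the argument works with the differences u_j -
    u_k, which are harmonic and do not change when one function is added to all the u_j. Domination
    bounds such a difference on one side only; bounds on the other side are carried from point to
    point along chains of discs, and the radii 17/16 and 33/32, slightly above 1, leave room for
    these discs. No limit of rescaled families is taken. Instead, the constants are uniform over all
    normalized families with a given index set, which replaces a normal family argument. The numbers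
    2n+1 and n+1 enter through 2(n+1) > 2n+1: the sets of almost maximal functions at any two points
    share a member. Roots of unity of order 2^K are used because their mesh is compatible with
    bisection. *)

Section ComplexModulus.
Variable R : realType.
Implicit Types (z w : R[i]) (x : R).

Lemma normc_normr z : (normc z)%:C = `|z|.
Proof. by rewrite normc_def; case: z. Qed.

Lemma normc_ge0 z : 0 <= normc z.
Proof. by case: z => a b; exact: sqrtr_ge0. Qed.

Lemma normc_gt0 z : (0 < normc z) = (z != 0).
Proof. by rewrite -ltcR normc_normr normr_gt0. Qed.

Lemma normc_eq0 z : (normc z == 0) = (z == 0).
Proof. by rewrite -[RHS]negbK -normc_gt0 lt_def normc_ge0 andbT negbK. Qed.

Lemma normcB z w : normc (z - w) = normc (w - z).
Proof. by rewrite -[RHS]normcN opprB. Qed.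

Lemma le_normcB z w : normc (z - w) <= normc z + normc w.
Proof. by rewrite -[normc w]normcN; exact: le_normcD. Qed.

Lemma ge_normcD z w : normc z - normc w <= normc (z + w).
Proof. by rewrite lerBlDr -{1}(addrK w z); exact: le_normcB. Qed.

Lemma le_normc_split w z1 z2 : normc (z1 - z2) <= normc (z1 - w) + normc (w - z2).
Proof. by rewrite -{1}(subrK w z1) -addrA; exact: le_normcD. Qed.

Lemma normcX z n : normc (z ^+ n) = normc z ^+ n.
Proof. by elim: n => [|n IH]; rewrite ?expr0 ?normc1 // !exprS normcM IH. Qed.

Lemma normc_div z w : normc (z / w) = normc z / normc w.
Proof. by rewrite normcM normcV. Qed.

Lemma normc_real x : normc x%:C = `|x|.
Proof. by rewrite /= expr0n addr0 sqrtr_sqr. Qed.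

Lemma normc_nat n : normc (n%:R : R[i]) = n%:R.
Proof. by rewrite -(rmorph_nat (real_complex R)) normc_real normr_nat. Qed.

Lemma normc_Re z : `|Re z| <= normc z.
Proof. by rewrite -lecR normc_normr normc_ge_Re. Qed.

Lemma Re_le_normc z : Re z <= normc z.
Proof. by apply: le_trans (normc_Re z); exact: ler_norm. Qed.

Lemma normc_Im z : `|Im z| <= normc z.
Proof. by case: z => a b /=; rewrite -sqrtr_sqr ler_wsqrtr // lerDr sqr_ge0. Qed.

Lemma normc_le_ReIm z : normc z <= `|Re z| + `|Im z|.
Proof.
case: z => a b /=.
rewrite -[leRHS]ger0_norm ?addr_ge0 // -sqrtr_sqr ler_wsqrtr // sqrrD.
by rewrite !real_normK ?num_real // addrAC lerDl mulrn_wge0 // mulr_ge0.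
Qed.

Lemma normc_sum (I : Type) (r : seq I) (P : pred I) (F : I -> R[i]) :
  normc (\sum_(i <- r | P i) F i) <= \sum_(i <- r | P i) normc (F i).
Proof.
elim/big_ind2: _ => //; first by rewrite normc0.
by move=> x1 y1 x2 y2 h1 h2; apply: le_trans (le_normcD _ _) (lerD h1 h2).
Qed.

Lemma normc_sum_le (n : nat) (F : nat -> R[i]) (B : R) :
  (forall k, (k < n)%N -> normc (F k) <= B) ->
  normc (\sum_(k < n) F k) <= n%:R * B.
Proof.
move=> h; apply: le_trans (normc_sum _ _ _) _.
rewrite -[n in n%:R]card_ord -sum1_card natr_sum mulr_suml.
by apply: ler_sum => i _; rewrite mul1r h.
Qed.

Lemma ReD z w : Re (z + w) = Re z + Re w.
Proof. by case: z w => a b [c d]. Qed.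

Lemma ReB z w : Re (z - w) = Re z - Re w.
Proof. by case: z w => a b [c d]. Qed.

Lemma ReZ x z : Re (x%:C * z) = x * Re z.
Proof. by case: z => a b /=; rewrite mul0r subr0. Qed.

Lemma Re_sum (I : Type) (r : seq I) (P : pred I) (F : I -> R[i]) :
  Re (\sum_(i <- r | P i) F i) = \sum_(i <- r | P i) Re (F i).
Proof. by apply: (big_morph (@Re R)) => // x y; rewrite ReD. Qed.

End ComplexModulus.

Section ComplexDerivative.
Variable R : realType.
Implicit Types (z w : R[i]) (f g : R[i] -> R[i]).

(** The norm of [R[i]^o] takes its values in [R[i]], whose positive elements are real; this passes
    to radii in [R]. *)
Lemma nbhs_normcP (z : R[i]^o) (P : set R[i]) :
  (\forall w \near z, P w) <->
  exists2 d : R, 0 < d & forall w, normc (w - z) < d -> P w.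
Proof.
split.
  move=> /nbhs_ballP [e /= e0 h].
  have er : e \is Num.real by exact: gtr0_real.
  exists (Re e); first by rewrite -ltcR RRe_real.
  move=> w hw; apply: h; rewrite /ball /= distrC -normc_normr.
  by rewrite -(RRe_real er) ltcR.
case=> d d0 h; apply/nbhs_ballP; exists d%:C => /=; first by rewrite ltcR.
by move=> w; rewrite /ball /= distrC -normc_normr ltcR; exact: h.
Qed.

(** Errors and radii are real, and the product form makes w = z harmless. *)
Definition has_cderiv f z d := forall e : R, 0 < e ->
  exists2 r : R, 0 < r & forall w, normc (w - z) < r ->
    normc (f w - f z - d * (w - z)) <= e * normc (w - z).

Lemma derivable_cderiv f z : derivable (f : R[i]^o -> R[i]^o) z 1 ->
  has_cderiv f z ('D_1 (f : R[i]^o -> R[i]^o) z).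
Proof.
move=> hd e e0.
have := hd => /cvg_ex [l hl].
have -> : 'D_1 (f : R[i]^o -> R[i]^o) z = l by apply/cvg_lim => //.
have e0' : (0 : R[i]) < e%:C by rewrite ltcR.
have /cvgrPdist_le /(_ _ e0') := hl.
rewrite near_withinE => /(@nbhs_normcP (0 : R[i]^o)) [r r0 h].
exists r => // w hw.
have [->|nz] := eqVneq w z.
  by rewrite !subrr mulr0 subrr normc0 mulr0.
have wz0 : w - z != 0 by rewrite subr_eq0.
have := h (w - z); rewrite subr0 => /(_ hw wz0) /=.
rewrite [_%:A]mulr1 subrK -normc_normr lecR => h1.
have -> : f w - f z - l * (w - z) = - (l - (w - z)^-1 *: (f w - f z)) * (w - z).
  by rewrite mulNr mulrBl -[_ *: _]/(_ * _) mulrAC mulVf // mul1r opprB.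
by rewrite normcM normcN ler_wpM2r // normc_ge0.
Qed.

Lemma cderiv_derivable f z d : has_cderiv f z d ->
  derivable (f : R[i]^o -> R[i]^o) z 1 /\ 'D_1 (f : R[i]^o -> R[i]^o) z = d.
Proof.
move=> h.
suff hl : (fun h : R[i]^o => h^-1 *: ((f : R[i]^o -> R[i]^o) (h *: 1 + z) - f z))
   @ 0^' --> (d : R[i]^o).
  by split; [apply/cvg_ex; exists d | apply/cvg_lim].
apply/cvgrPdist_le => e e0.
have er : e \is Num.real by exact: gtr0_real.
have e0' : 0 < Re e by rewrite -ltcR RRe_real.
have [r r0 hr] := h _ e0'.
rewrite near_withinE; apply/(@nbhs_normcP (0 : R[i]^o)); exists r => // w.
rewrite subr0 => hw w0.
rewrite [_%:A]mulr1 -normc_normr -(RRe_real er) lecR.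
have := hr (w + z); rewrite addrK => /(_ hw) h1.
have w0' : 0 < normc w by rewrite normc_gt0.
rewrite -(ler_pM2r w0') -normcM mulrBl -[_ *: _]/(_ * _) mulrAC mulVf // mul1r.
by rewrite normcB.
Qed.

End ComplexDerivative.

(** * Goursat's theorem *)

Section Cousin.
Variable R : realType.
Local Notation h n := ((2^-1 : R) ^+ n).

Lemma halfX_gt0 n : 0 < h n.
Proof. by rewrite exprn_gt0 // invr_gt0. Qed.

Lemma halfX_split n : h n = h n.+1 + h n.+1.
Proof. rewrite exprS; lra. Qed.

Lemma halfX_le1 n : h n <= 1.
Proof. by rewrite exprn_ile1 ?invr_ge0 ?invf_le1 ?ler1n ?ltr0n. Qed.

Lemma halfX_le m n : (m <= n)%N -> h n <= h m.
Proof. by move=> mn; rewrite ler_wiXn2l // ?invr_ge0 // invf_le1 ?ler1n ?ltr0n. Qed.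

Lemma halfX_small (e : R) : 0 < e -> exists N, forall n, (N <= n)%N -> h n < e.
Proof.
move=> e0; have [N _ hN] := near_infty_natSinv_expn_lt (PosNum e0).
exists N => n Nn; have := hN n Nn; rewrite /= => {}hN.
by rewrite exprVn -div1r.
Qed.

Lemma halfX_natr n K : (n <= K)%N -> (2 ^ (K - n))%:R * h K = h n.
Proof.
move=> nK; rewrite -{2}(subnK nK) exprD mulrA natrX -exprMn divff ?pnatr_eq0 //.
by rewrite expr1n mul1r.
Qed.

(** The common point is the supremum of the left endpoints. *)
Lemma nested_point (x : nat -> R) :
  (forall n, x n <= x n.+1 /\ x n.+1 + h n.+1 <= x n + h n) ->
  exists p, forall n, x n <= p <= x n + h n.
Proof.
move=> hx.
have mono m n : (m <= n)%N -> x m <= x n /\ x n + h n <= x m + h m.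
  elim: n => [|n IH]; first by rewrite leqn0 => /eqP ->.
  rewrite leq_eqVlt => /predU1P [-> //|]; rewrite ltnS => /IH [a b].
  by have [c d] := hx n; split; [apply: le_trans c | apply: le_trans d _].
have ubx n m : x m <= x n + h n.
  have [mn|/ltnW nm] := leqP m n.
    by rewrite (le_trans (mono _ _ mn).1) // lerDl ltW ?halfX_gt0.
  by apply: le_trans (mono _ _ nm).2; rewrite lerDl ltW ?halfX_gt0.
exists (sup (range x)) => n; apply/andP; split.
  by apply: ub_le_sup; [exists (x 0%N + h 0%N) => _ [m _ <-] | exists n].
by apply: ge_sup; [exists (x 0%N), 0%N | move=> _ [m _ <-]].
Qed.

(** Bisection in place of a covering argument: if the unit square failed, failing quarters would
    shrink to a point (p, q), against the local hypothesis there. [P x y n] refers to the square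
    with corner (x, y) and side 2^-n. Predicates independent of y give bisection of an interval. *)
Lemma cousin_square (P : R -> R -> nat -> Prop) :
  (forall x y n, P x y n.+1 -> P (x + h n.+1) y n.+1 -> P x (y + h n.+1) n.+1 ->
     P (x + h n.+1) (y + h n.+1) n.+1 -> P x y n) ->
  (forall p q, 0 <= p <= 1 -> 0 <= q <= 1 -> exists N, forall n x y, (N <= n)%N ->
     0 <= x -> x + h n <= 1 -> 0 <= y -> y + h n <= 1 ->
     x <= p <= x + h n -> y <= q <= y + h n -> P x y n) ->
  P 0 0 0%N.
Proof.
move=> Psub Ploc; apply: contrapT => nP0.
(* The failure of the square is assumed under the existential, so that [choice] gives a total
   function. *)
have step (t : nat * (R * R)) : exists u : R * R, ~ P t.2.1 t.2.2 t.1 ->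
   [/\ ~ P u.1 u.2 t.1.+1, u.1 = t.2.1 \/ u.1 = t.2.1 + h t.1.+1
     & u.2 = t.2.2 \/ u.2 = t.2.2 + h t.1.+1].
  case: t => n [x y] /=; apply: contrapT => /forallNP nex.
  suff Pn : P x y n by have /not_implyP [] := nex (0, 0).
  apply: Psub; apply: contrapT => nP.
  - by apply: (nex (x, y)) => _; split => //=; left.
  - by apply: (nex (x + h n.+1, y)) => _; split => //=; [right|left].
  - by apply: (nex (x, y + h n.+1)) => _; split => //=; [left|right].
  - by apply: (nex (x + h n.+1, y + h n.+1)) => _; split => //=; right.
have [F hF] := choice step.
pose s := fix s n := if n is m.+1 then F (m, s m) else (0, 0) : R * R.
have nPs n : ~ P (s n).1 (s n).2 n.
  by elim: n => [|n IH] //=; have [] := hF (n, s n) IH.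
have sS n : ((s n.+1).1 = (s n).1 \/ (s n.+1).1 = (s n).1 + h n.+1) /\
            ((s n.+1).2 = (s n).2 \/ (s n.+1).2 = (s n).2 + h n.+1).
  by have [] := hF (n, s n) (nPs n).
have nest (x : nat -> R) : (forall n, x n.+1 = x n \/ x n.+1 = x n + h n.+1) ->
   forall n, x n <= x n.+1 /\ x n.+1 + h n.+1 <= x n + h n.
  move=> hx n; have := halfX_gt0 n.+1; have := halfX_split n.
  by case: (hx n) => -> -> ?; split; lra.
have inI (x : nat -> R) : x 0%N = 0 -> (forall n, x n <= x n.+1 /\ x n.+1 + h n.+1 <= x n + h n) ->
   forall n, 0 <= x n /\ x n + h n <= 1.
  move=> x0 hx; elim=> [|n [a b]]; first by rewrite x0 expr0 add0r.
  by have [c d] := hx n; split; [apply: le_trans c|apply: le_trans b].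
have n1 := nest (fun n => (s n).1) (fun n => (sS n).1).
have n2 := nest (fun n => (s n).2) (fun n => (sS n).2).
have [p hp] := nested_point n1; have [q hq] := nested_point n2.
have i1 := inI _ erefl n1; have i2 := inI _ erefl n2.
have hp01 : 0 <= p <= 1 by have := hp 0%N; rewrite /= expr0 add0r.
have hq01 : 0 <= q <= 1 by have := hq 0%N; rewrite /= expr0 add0r.
have [N hN] := Ploc p q hp01 hq01.
apply: (nPs N); apply: hN => //.
- by have [] := i1 N.
- by have [] := i1 N.
- by have [] := i2 N.
- by have [] := i2 N.
Qed.

End Cousin.

Section RiemannSum.
Variable R : realType.
Implicit Types (g : R[i] -> R[i]) (gam : nat -> R[i]).

Definition rsum g gam N := \sum_(k < N) g (gam k) * (gam k.+1 - gam k).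

Lemma rsum_cat g gam N M :
  rsum g gam (N + M) = rsum g gam N + rsum g (fun k => gam (N + k)%N) M.
Proof.
rewrite /rsum big_split_ord /=; congr (_ + _).
by apply: eq_bigr => i _; rewrite addnS.
Qed.

Lemma eq_rsum g gam gam' N : gam =1 gam' -> rsum g gam N = rsum g gam' N.
Proof. by move=> e; apply: eq_bigr => i _; rewrite !e. Qed.

Lemma rsum_le g gam N (B l : R) :
  (forall k, (k < N)%N -> normc (g (gam k)) <= B) ->
  (forall k, (k < N)%N -> normc (gam k.+1 - gam k) <= l) ->
  normc (rsum g gam N) <= N%:R * (B * l).
Proof.
move=> hB hl; apply: (@normc_sum_le R N (fun k => g (gam k) * (gam k.+1 - gam k))).
by move=> k kN; rewrite normcM ler_pM ?normc_ge0 ?hB ?hl.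
Qed.

Lemma sum_telescope (u : nat -> R[i]) N : \sum_(k < N) (u k.+1 - u k) = u N - u 0%N.
Proof.
elim: N => [|N IH]; first by rewrite big_ord0 subrr.
by rewrite big_ord_recr /= IH addrC addrA subrK.
Qed.

(** A primitive of a + b z. *)
Definition affine_primitive (a b z : R[i]) := a * z + b / 2 * z ^+ 2.

(** Replace g by its affine approximation at z0. Increments of the primitive telescope; each step
    costs |d|/2 l^2 for the quadratic term of the primitive and e r l for the approximation. *)
Lemma rsum_affine_le g gam N z0 d (e r l : R) : 0 <= e ->
  (forall k, (k < N)%N ->
     normc (g (gam k) - g z0 - d * (gam k - z0)) <= e * normc (gam k - z0)) ->
  (forall k, (k < N)%N -> normc (gam k - z0) <= r) ->
  (forall k, (k < N)%N -> normc (gam k.+1 - gam k) <= l) ->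
  normc (rsum g gam N - (affine_primitive (g z0 - d * z0) d (gam N)
                         - affine_primitive (g z0 - d * z0) d (gam 0%N))) <=
    N%:R * (normc d / 2 * l ^+ 2 + e * r * l).
Proof.
move=> e0 herr hr hl; set A := affine_primitive _ _.
rewrite -(sum_telescope (fun k => A (gam k))) /rsum -sumrB.
apply: (@normc_sum_le R N (fun k =>
  g (gam k) * (gam k.+1 - gam k) - (A (gam k.+1) - A (gam k)))) => k kN.
set a := gam k; set b := gam k.+1.
have -> : g a * (b - a) - (A b - A a) =
  (g a - g z0 - d * (a - z0)) * (b - a) - d / 2 * (b - a) ^+ 2.
  by rewrite /A /affine_primitive; field.
have l0 : 0 <= l by apply: le_trans (hl k kN); exact: normc_ge0.
apply: le_trans (le_normcB _ _) _; rewrite addrC; apply: lerD.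
  rewrite normcM normcX normc_div (normc_nat _ 2) ler_wpM2l ?divr_ge0 ?normc_ge0 //.
  by rewrite ler_pXn2r ?nnegrE ?normc_ge0 // hl.
rewrite normcM ler_pM ?normc_ge0 ?hl //.
apply: le_trans (herr k kN) _; rewrite ler_wpM2l // hr //.
Qed.

End RiemannSum.

Section Goursat.
Variable R : realType.

Lemma itv_sub (x l s : R) : 0 <= x -> x + l <= 1 -> x <= s <= x + l -> 0 <= s <= 1.
Proof. lra. Qed.

Lemma itv_dist (x l s p : R) : x <= s <= x + l -> x <= p <= x + l -> `|s - p| <= l.
Proof. by rewrite ler_norml; lra. Qed.

Lemma itv_shift (x l t : R) : 0 <= t <= l -> x <= x + t <= x + l.
Proof. lra. Qed.

Local Notation h n := ((2^-1 : R) ^+ n).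
Variables (g : R[i] -> R[i]) (Phi : R -> R -> R[i]).

Definition hedge x y K k := Phi (x + k%:R * h K) y.
Definition vedge x y K k := Phi x (y + k%:R * h K).

(* The Riemann sum of g along the image of the boundary of the square of side
   N * 2^-K with lower left corner (x, y). *)
Definition square_sum x y K N :=
  rsum g (hedge x y K) N + rsum g (vedge (x + N%:R * h K) y K) N
  - rsum g (hedge x (y + N%:R * h K) K) N - rsum g (vedge x y K) N.

Lemma square_sum_split x y K N : let a := N%:R * h K in
  square_sum x y K (N + N) = square_sum x y K N + square_sum (x + a) y K N
    + square_sum x (y + a) K N + square_sum (x + a) (y + a) K N.
Proof.
move=> a; rewrite /square_sum !rsum_cat !natrD !mulrDl -/a !addrA.
have eh u v : rsum g (fun k => hedge u v K (N + k)) N = rsum g (hedge (u + a) v K) N.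
  by apply: eq_rsum => k; rewrite /hedge natrD mulrDl addrA.
have ev u v : rsum g (fun k => vedge u v K (N + k)) N = rsum g (vedge u (v + a) K) N.
  by apply: eq_rsum => k; rewrite /vedge natrD mulrDl addrA.
rewrite !eh !ev; ring.
Qed.

Variable L : R.
Hypothesis L0 : 0 < L.
Hypothesis Phi1 : forall s s' t, 0 <= s <= 1 -> 0 <= s' <= 1 -> 0 <= t <= 1 ->
  normc (Phi s t - Phi s' t) <= L * `|s - s'|.
Hypothesis Phi2 : forall s t t', 0 <= s <= 1 -> 0 <= t <= 1 -> 0 <= t' <= 1 ->
  normc (Phi s t - Phi s t') <= L * `|t - t'|.
Hypothesis gder : forall s t, 0 <= s <= 1 -> 0 <= t <= 1 ->
  exists d, has_cderiv g (Phi s t) d.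

(** The bound is proportional to the area, hence adds up over a subdivision. The threshold [K0] may
    depend on the square, because each bisection step takes a maximum of four. *)
Lemma square_sum_local p q (eta : R) : 0 < eta -> 0 <= p <= 1 -> 0 <= q <= 1 ->
  exists N, forall n x y, (N <= n)%N ->
     0 <= x -> x + h n <= 1 -> 0 <= y -> y + h n <= 1 ->
     x <= p <= x + h n -> y <= q <= y + h n ->
  exists K0, forall K, (K0 <= K)%N -> (n <= K)%N ->
    normc (square_sum x y K (2 ^ (K - n))) <= eta * h n ^+ 2.
Proof.
move=> eta0 hp hq; have [d hd] := gder hp hq.
(* The approximation error is 2 e L^2 (h n)^2 on each edge, half of the allowed total over four
   edges. The quadratic terms take the other half once [h K] is small. *)
pose e := eta / (16 * L ^+ 2).
have L2 : 0 < L ^+ 2 by rewrite exprn_gt0.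
have e0 : 0 < e by rewrite divr_gt0 // mulr_gt0.
have [r r0 hr] := hd e e0.
have rL : 0 < r / (2 * L) by rewrite divr_gt0 // mulr_gt0.
have [N hN] := halfX_small rL.
exists N => n x y Nn x0 x1 y0 y1 xp yq.
have hn0 := halfX_gt0 R n.
have D1 : 0 < normc d + 1 by rewrite ltr_wpDl ?normc_ge0.
have e'0 : 0 < eta * h n / (4 * L ^+ 2 * (normc d + 1)).
  by rewrite divr_gt0 ?mulr_gt0.
have [K0 hK0] := halfX_small e'0.
exists K0 => K K0K nK.
set M := (2 ^ (K - n))%N.
have MK : M%:R * h K = h n by exact: halfX_natr.
have hK := hK0 K K0K; have hKp := halfX_gt0 R K.
have kin k : (k <= M)%N -> 0 <= k%:R * h K <= h n.
  move=> kM; apply/andP; split; first by rewrite mulr_ge0 ?ler0n ?(ltW hKp).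
  by rewrite -MK ler_pM2r // ler_nat.
set z0 := Phi p q.
pose A := affine_primitive (g z0 - d * z0) d.
have edge gam :
  (forall k, (k <= M)%N -> exists s t,
     [/\ gam k = Phi s t, x <= s <= x + h n & y <= t <= y + h n]) ->
  (forall k, (k < M)%N -> normc (gam k.+1 - gam k) <= L * h K) ->
  normc (rsum g gam M - (A (gam M) - A (gam 0%N))) <=
    h n * (normc d / 2 * L ^+ 2 * h K + e * (2 * L * h n) * L).
  move=> hst hl.
  have hdist k : (k < M)%N -> normc (gam k - z0) <= 2 * L * h n.
    move=> /ltnW /hst [s [t [-> hs ht]]].
    apply: le_trans (le_normc_split (Phi p t) _ _) _.
    have -> : 2 * L * h n = L * h n + L * h n by ring.
    apply: lerD.
      apply: le_trans (Phi1 (itv_sub x0 x1 hs) hp (itv_sub y0 y1 ht)) _.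
      by rewrite ler_pM2l // (itv_dist hs xp).
    apply: le_trans (Phi2 hp (itv_sub y0 y1 ht) hq) _.
    by rewrite ler_pM2l // (itv_dist ht yq).
  have herr k : (k < M)%N ->
     normc (g (gam k) - g z0 - d * (gam k - z0)) <= e * normc (gam k - z0).
    move=> kM; apply: hr; apply: le_lt_trans (hdist k kM) _.
    by have := hN n Nn; rewrite ltr_pdivlMr ?mulr_gt0 // mulrC.
  apply: le_trans (rsum_affine_le (ltW e0) herr hdist hl) _.
  by rewrite -MK le_eqVlt; apply/orP; left; apply/eqP; ring.
have hE v : y <= v <= y + h n ->
   normc (rsum g (hedge x v K) M - (A (hedge x v K M) - A (hedge x v K 0%N))) <=
    h n * (normc d / 2 * L ^+ 2 * h K + e * (2 * L * h n) * L).
  move=> hv; apply: edge => [k kM|k kM].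
    by exists (x + k%:R * h K), v; split => //; exact/itv_shift/kin.
  have k1 := itv_shift x (kin k (ltnW kM)); have k2 := itv_shift x (kin k.+1 kM).
  apply: le_trans (Phi1 (itv_sub x0 x1 k2) (itv_sub x0 x1 k1) (itv_sub y0 y1 hv)) _.
  have -> : x + k.+1%:R * h K - (x + k%:R * h K) = h K by rewrite -natr1; ring.
  by rewrite ger0_norm // ltW.
have vE u : x <= u <= x + h n ->
   normc (rsum g (vedge u y K) M - (A (vedge u y K M) - A (vedge u y K 0%N))) <=
    h n * (normc d / 2 * L ^+ 2 * h K + e * (2 * L * h n) * L).
  move=> hu; apply: edge => [k kM|k kM].
    by exists u, (y + k%:R * h K); split => //; exact/itv_shift/kin.
  have k1 := itv_shift y (kin k (ltnW kM)); have k2 := itv_shift y (kin k.+1 kM).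
  apply: le_trans (Phi2 (itv_sub x0 x1 hu) (itv_sub y0 y1 k2) (itv_sub y0 y1 k1)) _.
  have -> : y + k.+1%:R * h K - (y + k%:R * h K) = h K by rewrite -natr1; ring.
  by rewrite ger0_norm // ltW.
have x1' : x <= x <= x + h n by rewrite lexx lerDl ltW.
have x2' : x <= x + h n <= x + h n by rewrite lexx lerDl ltW.
have y1' : y <= y <= y + h n by rewrite lexx lerDl ltW.
have y2' : y <= y + h n <= y + h n by rewrite lexx lerDl ltW.
have b1 := hE _ y1'; have b2 := hE _ y2'; have b3 := vE _ x1'; have b4 := vE _ x2'.
rewrite /square_sum MK.
move: b1 b2 b3 b4; rewrite /hedge /vedge MK mul0r !addr0.
set s1 := rsum _ _ _; set s2 := rsum _ _ _; set s3 := rsum _ _ _; set s4 := rsum _ _ _.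
set A1 := A _; set A2 := A _; set A3 := A _; set A4 := A _.
move=> b1 b2 b3 b4.
(* The increments of the primitive cancel around the closed boundary. *)
have -> : s1 + s4 - s2 - s3 = (s1 - (A1 - A2)) + (s4 - (A3 - A1))
    - (s2 - (A3 - A4)) - (s3 - (A4 - A2)) by ring.
apply: le_trans (le_normcB _ _) _.
apply: le_trans (lerD (le_normcB _ _) b3) _.
apply: le_trans (lerD (lerD (le_normcD _ _) b2) (lexx _)) _.
apply: le_trans (lerD (lerD (lerD b1 b4) (lexx _)) (lexx _)) _.
have hdK : normc d * (4 * L ^+ 2 * h K) <= eta * h n.
  have := hK; rewrite ltr_pdivlMr ?mulr_gt0 // => hK'.
  by have := mulr_gt0 hKp L2; clear -hK'; lra.
have eE : e * (16 * L ^+ 2) = eta by rewrite /e divfK // gt_eqF // mulr_gt0.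
have -> : forall c : R, h n * c + h n * c + h n * c + h n * c = h n * (4 * c) by move=> c; ring.
rewrite expr2 [leRHS]mulrCA ler_pM2l //.
have -> : 4 * (normc d / 2 * L ^+ 2 * h K + e * (2 * L * h n) * L) =
   (normc d * (4 * L ^+ 2 * h K)) / 2 + (e * (16 * L ^+ 2)) * h n / 2 by field.
by rewrite eE; clear -hdK; lra.
Qed.

Lemma goursat (eta : R) : 0 < eta -> exists K0, forall K, (K0 <= K)%N ->
  normc (square_sum 0 0 K (2 ^ K)) <= eta.
Proof.
move=> eta0.
have := @cousin_square R (fun x y n => exists K0, forall K, (K0 <= K)%N -> (n <= K)%N ->
    normc (square_sum x y K (2 ^ (K - n))) <= eta * h n ^+ 2).
case.
- move=> x y n [K1 h1] [K2 h2] [K3 h3] [K4 h4].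
  exists (maxn n.+1 (maxn (maxn K1 K2) (maxn K3 K4))) => K.
  rewrite !geq_max => /and3P [nK /andP[k1 k2] /andP[k3 k4]] _.
  have -> : (K - n = (K - n.+1).+1)%N by rewrite subnSK.
  rewrite expnS mul2n -addnn square_sum_split halfX_natr //.
  move: (h1 _ k1 nK) (h2 _ k2 nK) (h3 _ k3 nK) (h4 _ k4 nK) => b1 b2 b3 b4.
  apply: le_trans (le_normcD _ _) _; apply: le_trans (lerD (le_normcD _ _) b4) _.
  apply: le_trans (lerD (lerD (le_normcD _ _) b3) (lexx _)) _.
  apply: le_trans (lerD (lerD (lerD b1 b2) (lexx _)) (lexx _)) _.
  by rewrite (halfX_split R n) le_eqVlt; apply/orP; left; apply/eqP; ring.
- by move=> p q hp hq; exact: square_sum_local.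
- move=> K0 hK0; exists K0 => K /hK0 /(_ isT).
  by rewrite subn0 expr0 expr1n mulr1.
Qed.

End Goursat.

(** * Averages over dyadic roots of unity *)

Section Cis.
Variable R : realType.
Local Notation h n := ((2^-1 : R) ^+ n).
Implicit Types (s t : R).

(* exp (2 i pi t) *)
Definition cis t : R[i] := cos (pi *+ 2 * t) +i* sin (pi *+ 2 * t).

Lemma cis0 : cis 0 = 1.
Proof. by rewrite /cis mulr0 cos0 sin0. Qed.

Lemma cis1 : cis 1 = 1.
Proof. by rewrite /cis mulr1 cos2pi sin2pi. Qed.

Lemma cis_half : cis 2^-1 = -1.
Proof.
rewrite /cis (_ : pi *+ 2 * 2^-1 = pi) ?cospi ?sinpi; last by field.
by apply/eqP; rewrite eq_complex /= oppr0 !eqxx.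
Qed.

Lemma cisD s t : cis (s + t) = cis s * cis t.
Proof.
rewrite /cis mulrDr cosD sinD; apply/eqP; rewrite eq_complex /= eqxx /=.
by apply/eqP; ring.
Qed.

Lemma cis_natr k t : cis (k%:R * t) = cis t ^+ k.
Proof.
elim: k => [|k IH]; first by rewrite mul0r cis0 expr0.
by rewrite -natr1 mulrDl mul1r cisD IH exprSr.
Qed.

Lemma normc_cis t : normc (cis t) = 1.
Proof. by rewrite /cis /= cos2Dsin2 sqrtr1. Qed.

Lemma cis_neq0 t : cis t != 0.
Proof. by rewrite -normc_gt0 normc_cis ltr01. Qed.

Lemma lipschitz1 (F dF : R -> R) s t : (forall x : R, is_derive x 1 F (dF x)) ->
  (forall x, `|dF x| <= 1) -> `|F s - F t| <= `|s - t|.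
Proof.
move=> hF hd.
wlog st : s t / s <= t.
  move=> W; have [/W //|/ltW /W] := leP s t.
  by rewrite distrC => H; rewrite [leRHS]distrC.
have cF : {within `[s, t], continuous F}.
  apply: derivable_within_continuous => x _.
  by have := hF x => hx; exact: ex_derive.
have [x _ e] := MVT_segment st (fun x _ => hF x) cF.
by rewrite distrC e normrM [leRHS]distrC ler_piMl.
Qed.

Lemma lipschitz_cos s t : `|cos s - cos t| <= `|s - t|.
Proof.
apply: (@lipschitz1 _ (fun x => - sin x)) => x.
by rewrite normrN ler_norml sin_geN1 sin_le1.
Qed.

Lemma lipschitz_sin s t : `|sin s - sin t| <= `|s - t|.
Proof.
apply: (@lipschitz1 _ (fun x => cos x)) => x.
by rewrite ler_norml cos_geN1 cos_le1.
Qed.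

Definition cis_lip : R := pi *+ 2 + pi *+ 2.

Lemma cis_lip_gt0 : 0 < cis_lip.
Proof. by rewrite /cis_lip addr_gt0 // pmulrn_lgt0 // pi_gt0. Qed.

Lemma lipschitz_cis s t : normc (cis s - cis t) <= cis_lip * `|s - t|.
Proof.
apply: le_trans (normc_le_ReIm _) _.
rewrite /cis /=.
apply: le_trans (lerD (lipschitz_cos _ _) (lipschitz_sin _ _)) _.
have p0 : 0 <= pi *+ 2 :> R by rewrite mulrn_wge0 // pi_ge0.
have -> : `|pi *+ 2 * s - pi *+ 2 * t| = pi *+ 2 * `|s - t|.
  by rewrite -mulrBr normrM (ger0_norm p0).
by rewrite -mulrDl.
Qed.

Definition omega K := cis (h K).

Lemma omegaX K k : omega K ^+ k = cis (k%:R * h K).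
Proof. by rewrite cis_natr. Qed.

Lemma normc_omegaX K k : normc (omega K ^+ k) = 1.
Proof. by rewrite omegaX normc_cis. Qed.

Lemma omegaX_neq0 K k : omega K ^+ k != 0.
Proof. by rewrite omegaX cis_neq0. Qed.

Lemma omega_expr K : omega K ^+ (2 ^ K) = 1.
Proof. by rewrite omegaX -{1}(subn0 K) halfX_natr // expr0 cis1. Qed.

Lemma omega_expr_half K : omega K.+1 ^+ (2 ^ K) = -1.
Proof.
by rewrite omegaX -[X in (2 ^ X)%N](subn1 K.+1) halfX_natr // expr1 cis_half.
Qed.

(** Half of the equal chords already lead from 1 to -1. The product bounded here is the discrete
    counterpart of |2 i pi| in Cauchy's formula. *)
Lemma omega_far K : 2 <= (2 ^ K.+1)%:R * normc (omega K.+1 - 1).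
Proof.
have step (z : R[i]) k : normc z = 1 -> normc (z ^+ k - 1) <= k%:R * normc (z - 1).
  move=> z1; elim: k => [|k IH]; first by rewrite expr0 subrr normc0 mul0r.
  rewrite -natr1 mulrDl mul1r.
  have -> : z ^+ k.+1 - 1 = z * (z ^+ k - 1) + (z - 1) by rewrite exprS; ring.
  apply: le_trans (le_normcD _ _) _.
  by rewrite lerD2r normcM z1 mul1r.
have := step (omega K.+1) (2 ^ K)%N (normc_cis _).
rewrite omega_expr_half -opprD normcN (_ : 1 + 1 = 2%:R) // normc_nat => h2.
apply: le_trans h2 _; rewrite ler_wpM2r ?normc_ge0 // ler_nat leq_exp2l //.
Qed.

Definition avg K (F : R[i] -> R[i]) := (2 ^ K)%:R^-1 * \sum_(k < 2 ^ K) F (omega K ^+ k).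

Lemma pow2C_neq0 K : (2 ^ K)%:R != 0 :> R[i].
Proof. by rewrite pnatr_eq0 -lt0n expn_gt0. Qed.

Lemma avg_le K F (B : R) : (forall k, (k < 2 ^ K)%N -> normc (F (omega K ^+ k)) <= B) ->
  normc (avg K F) <= B.
Proof.
move=> hF; rewrite normcM normcV normc_nat.
rewrite ler_pdivrMl ?ltr0n ?expn_gt0 //.
exact: (@normc_sum_le R (2 ^ K) (fun k => F (omega K ^+ k))).
Qed.

Lemma avgD K F G : avg K (fun z => F z + G z) = avg K F + avg K G.
Proof. by rewrite /avg big_split mulrDr. Qed.

Lemma avgB K F G : avg K (fun z => F z - G z) = avg K F - avg K G.
Proof. by rewrite /avg sumrB mulrBr. Qed.

Lemma avgZ K a F : avg K (fun z => a * F z) = a * avg K F.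
Proof. by rewrite /avg -mulr_sumr mulrCA. Qed.

Lemma avg_sum K M (F : nat -> R[i] -> R[i]) :
  avg K (fun z => \sum_(m < M) F m z) = \sum_(m < M) avg K (F m).
Proof. by rewrite /avg exchange_big /= mulr_sumr. Qed.

Lemma eq_avg K F G : (forall k, F (omega K ^+ k) = G (omega K ^+ k)) -> avg K F = avg K G.
Proof. by move=> e; rewrite /avg; congr (_ * _); apply: eq_bigr => k _; rewrite e. Qed.

Lemma avg_cst K a : avg K (fun=> a) = a.
Proof.
rewrite /avg sumr_const card_ord -[a *+ _]mulr_natl mulrA mulVf ?pow2C_neq0 //.
by rewrite mul1r.
Qed.

(** The order of [omega K] is a power of two dividing 2^K, and a proper divisor is excluded because
    half of the exponent 2^K gives -1. *)
Lemma omegaX_neq1 K j : (0 < j < 2 ^ K)%N -> omega K ^+ j != 1.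
Proof.
move=> /andP[j0 jK]; have [|m hm md] := @prim_order_exists _ (2 ^ K) (omega K) _ (omega_expr K).
  by rewrite expn_gt0.
have [i iK em] := elimT (dvdn_pfactor _ _ (isT : prime 2)) md.
have {}iK : i = K.
  apply/eqP; rewrite eqn_leq iK /= leqNgt; apply/negP => iK'.
  case: K iK' hm {j0 jK md iK} => // K; rewrite ltnS => iK hm.
  have : omega K.+1 ^+ (2 ^ K) == 1 by rewrite -(prim_order_dvd hm) em dvdn_exp2l.
  rewrite omega_expr_half => /eqP /(congr1 (@complex.Re R)) /= /eqP.
  by rewrite -subr_eq0 -opprD oppr_eq0 (_ : 1 + 1 = 2%:R) // pnatr_eq0.
rewrite -(prim_order_dvd hm) em iK.
by apply/negP => /(dvdn_leq j0); rewrite leqNgt jK.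
Qed.

Lemma avg_expr K j : (0 < j < 2 ^ K)%N -> avg K (fun z => z ^+ j) = 0.
Proof.
move=> hj; have n1 := omegaX_neq1 hj.
rewrite /avg; under eq_bigr => k _ do rewrite -exprM mulnC exprM.
suff -> : \sum_(k < 2 ^ K) (omega K ^+ j) ^+ k = 0 by rewrite mulr0.
apply: (@mulfI _ (omega K ^+ j - 1)); first by rewrite subr_eq0.
by rewrite -subrX1 -exprM mulnC exprM omega_expr expr1n subrr mulr0.
Qed.

Lemma avg_exprV K j : (0 < j < 2 ^ K)%N -> avg K (fun z => z ^- j) = 0.
Proof.
move=> /andP[j0 jK]; rewrite -(@avg_expr K (2 ^ K - j)); last first.
  by rewrite subn_gt0 jK ltn_subrL j0 expn_gt0.
apply: eq_avg => k; apply: (@mulIf _ ((omega K ^+ k) ^+ j)).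
  by rewrite expf_neq0 // omegaX_neq0.
rewrite -exprD subnK ?(ltnW jK) // mulVf ?expf_neq0 ?cis_neq0 //.
by rewrite -exprM mulnC exprM omega_expr expr1n.
Qed.

End Cis.

(** * Cauchy's formula *)

Section Entire.
Variable R : realType.
Local Notation h n := ((2^-1 : R) ^+ n).
Implicit Types (f g : R[i] -> R[i]).

Definition entire f := forall z, derivable (f : R[i]^o -> R[i]^o) z 1.

Definition cderiv f (z : R[i]) : R[i] := 'D_1 (f : R[i]^o -> R[i]^o) z.

Lemma entire_cderiv f z : entire f -> has_cderiv f z (cderiv f z).
Proof. by move=> ef; exact: derivable_cderiv. Qed.

Lemma has_cderiv_entire f : (forall z, exists d, has_cderiv f z d) -> entire f.
Proof. by move=> hf z; have [d /cderiv_derivable []] := hf z. Qed.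

Lemma has_cderiv_bound f z d : has_cderiv f z d -> exists2 r : R, 0 < r &
  forall w, normc (w - z) < r -> normc (f w - f z) <= (normc d + 1) * normc (w - z).
Proof.
move=> /(_ _ ltr01) [r r0 hr]; exists r => // w /hr; rewrite mul1r => hw.
rewrite -(subrK (d * (w - z)) (f w - f z)) mulrDl mul1r addrC.
by apply: le_trans (le_normcD _ _) _; rewrite normcM lerD2l.
Qed.

Lemma entire_affine f c r : entire f -> entire (fun z => f (c + r * z)).
Proof.
move=> ef; apply: has_cderiv_entire => z; exists (cderiv f (c + r * z) * r) => e e0.
have r1 : 0 < normc r + 1 by rewrite ltr_wpDl ?normc_ge0.
have [d d0 hd] := entire_cderiv (c + r * z) ef (divr_gt0 e0 r1).
exists (d / (normc r + 1)) => [|w hw]; first exact: divr_gt0.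
have e1 : c + r * w - (c + r * z) = r * (w - z) by ring.
have := hd (c + r * w); rewrite e1 normcM.
have rr : normc r <= normc r + 1 by rewrite lerDl.
have -> : normc r * normc (w - z) < d.
  move: hw; rewrite ltr_pdivlMr // mulrC; apply: le_lt_trans.
  by rewrite ler_wpM2r ?normc_ge0.
move=> /(_ isT); rewrite -mulrA => h1; apply: le_trans h1 _.
rewrite -mulrA ler_wpM2l ?(ltW e0) // mulrA ler_piMl ?normc_ge0 //.
by rewrite mulrC ler_pdivrMr // mul1r.
Qed.

(** Local boundedness spreads over the circle by bisection of the parameter interval. *)
Lemma entire_bounded_circle f : entire f ->
  exists2 B : R, 0 < B & forall K k, (k <= 2 ^ K)%N -> normc (f (omega R K ^+ k)) <= B.
Proof.
move=> ef.
suff [B hB] : exists B : R, forall s, 0 <= s <= 0 + h 0 -> normc (f (cis s)) <= B.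
  exists (`|B| + 1) => [|K k kK]; first by rewrite ltr_wpDl.
  rewrite omegaX; apply: (@le_trans _ _ B); last by rewrite ler_wpDr // ler_norm.
  apply: hB; rewrite add0r expr0 mulr_ge0 ?ler0n ?(ltW (halfX_gt0 _ _)) //=.
  rewrite -[leRHS](expr0 2^-1) -(halfX_natr R (leq0n K)) subn0.
  by rewrite ler_wpM2r ?(ltW (halfX_gt0 _ _)) // ler_nat.
have := @cousin_square R (fun x y n => exists B, forall s, x <= s <= x + h n ->
  normc (f (cis s)) <= B).
apply.
- move=> x y n [B1 h1] [B2 h2] _ _; exists (Num.max B1 B2) => s.
  rewrite (halfX_split R n) addrA => /andP [s1 s2].
  by have [s3|s3] := leP s (x + h n.+1); rewrite le_max; apply/orP;
     [left; apply: h1; rewrite s1|right; apply: h2; rewrite (ltW s3)].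
- move=> p q hp hq.
  have [r r0 hr] := has_cderiv_bound (entire_cderiv (cis p) ef).
  have [N hN] := halfX_small (divr_gt0 r0 (cis_lip_gt0 R)).
  exists N => n x y Nn _ _ _ _ xp _.
  set d := normc _ + 1 in hr; exists (normc (f (cis p)) + d * r) => s hs.
  rewrite -(subrK (f (cis p)) (f (cis s))) addrC.
  have hs' : normc (cis s - cis p) < r.
    apply: le_lt_trans (lipschitz_cis _ _) _.
    have := hN n Nn; rewrite ltr_pdivlMr ?cis_lip_gt0 // mulrC; apply: le_lt_trans.
    by rewrite ler_pM2l ?cis_lip_gt0 // (itv_dist hs xp).
  apply: le_trans (le_normcD _ _) _; rewrite lerD2l.
  apply: le_trans (hr _ hs') _; rewrite ler_wpM2l ?(ltW hs') //.
  by rewrite addr_ge0 ?normc_ge0.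
Qed.

(* Goursat's theorem for (f z - f a) / (z - a) on the annulus between the unit
   circle and its image under a homothety of centre a and small ratio tau. The
   quotient is bounded near a, so the inner sum is O(tau). *)
Lemma cauchy_avg f a : entire f -> normc a < 1 -> forall eta : R, 0 < eta ->
  \forall K \near \oo, normc (avg K (fun z => (f z - f a) / (z - a) * z)) <= eta.
Proof.
move=> ef a1 eta eta0.
pose g z := (f z - f a) / (z - a).
have [r r0 hr] := has_cderiv_bound (entire_cderiv a ef).
set B := normc _ + 1 in hr.
have B0 : 0 < B by rewrite ltr_wpDl ?normc_ge0.
have gB w : normc (w - a) < r -> normc (g w) <= B.
  move=> /hr hw; rewrite /g; have [->|wa] := eqVneq w a.
    by rewrite subrr mul0r normc0 ltW.
  by rewrite normc_div ler_pdivrMr // normc_gt0 subr_eq0.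
set L := cis_lip R; have L0 : 0 < L := cis_lip_gt0 R.
(* As |cis t - a| <= 2, the bound r / 4 puts the inner curve where |g| <= B. Its Riemann sum is then
   at most tau B L, hence at most eta. *)
pose tau := Num.min 2^-1 (Num.min (r / 4) (eta / (B * L))).
have tau0 : 0 < tau by rewrite !lt_min invr_gt0 ltr0n !divr_gt0 ?mulr_gt0.
have tau1 : tau <= 2^-1 by rewrite ge_min lexx.
have tau2 : tau <= r / 4 by rewrite !ge_min lexx orbT.
have tau3 : tau <= eta / (B * L) by rewrite !ge_min lexx !orbT.
pose sig s : R := tau + (1 - tau) * s.
pose Phi s t : R[i] := a + (sig s)%:C * (cis t - a).
have cisa t : 0 < normc (cis t - a).
  by rewrite normc_gt0 subr_eq0; apply: contraTneq a1 => <-; rewrite normc_cis ltxx.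
have cisa2 t : normc (cis t - a) <= 2.
  apply: le_trans (le_normcB _ _) _; rewrite normc_cis (_ : 2 = 1 + 1) // lerD2l.
  exact: ltW.
have sig01 s : 0 <= s <= 1 -> tau <= sig s <= 1.
  by rewrite /sig; clear -tau1 tau0; nra.
have Phi1 s s' t : 0 <= s <= 1 -> 0 <= s' <= 1 -> 0 <= t <= 1 ->
  normc (Phi s t - Phi s' t) <= (L + 2) * `|s - s'|.
  move=> _ _ _.
  have -> : Phi s t - Phi s' t = ((1 - tau) * (s - s'))%:C * (cis t - a).
    rewrite /Phi opprD addrACA subrr add0r -mulrBl -rmorphB; congr (_%:C * _).
    by rewrite /sig; ring.
  rewrite normcM normc_real normrM ger0_norm; last by lra.
  rewrite mulrAC ler_wpM2r //; apply: (@le_trans _ _ (1 * 2)); last by lra.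
  by apply: ler_pM => //; rewrite ?normc_ge0 //; lra.
have Phi2 s t t' : 0 <= s <= 1 -> 0 <= t <= 1 -> 0 <= t' <= 1 ->
  normc (Phi s t - Phi s t') <= (L + 2) * `|t - t'|.
  move=> /sig01 /andP[s0 s1] _ _.
  have -> : Phi s t - Phi s t' = (sig s)%:C * (cis t - cis t').
    by rewrite /Phi; ring.
  rewrite normcM normc_real ger0_norm; last by apply: le_trans s0; exact: ltW.
  apply: (@le_trans _ _ (1 * (L * `|t - t'|))).
    apply: ler_pM => //; rewrite ?normc_ge0 ?lipschitz_cis //.
    by apply: le_trans s0; exact: ltW.
  by rewrite mul1r ler_wpM2r // lerDl.
have gder s t : 0 <= s <= 1 -> 0 <= t <= 1 -> exists d, has_cderiv g (Phi s t) d.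
  move=> /sig01 /andP[s0 s1] _.
  exists ('D_1 (g : R[i]^o -> R[i]^o) (Phi s t)); apply: derivable_cderiv.
  have za : Phi s t - a != 0.
    rewrite /Phi addrAC subrr add0r mulf_neq0 -?normc_gt0 // normc_real normr_gt0.
    by rewrite gt_eqF // (lt_le_trans tau0 s0).
  apply: (@derivableM _ _ (fun z : R[i]^o => f z - f a : R[i]^o)
    (fun z : R[i]^o => (z - a)^-1 : R[i]^o)).
    by apply: derivableB; [exact: ef|exact: derivable_cst].
  apply: (@derivableV _ _ (fun z : R[i]^o => z - a : R[i]^o)); first exact: za.
  by apply: derivableB; [exact: derivable_id|exact: derivable_cst].
have L2 : 0 < L + 2 by rewrite addr_gt0.
have [K0 hK0] := goursat L2 Phi1 Phi2 gder eta0.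
exists (maxn 1 K0) => // K /=; rewrite geq_max => /andP[K1 K0K].
have := hK0 K K0K; rewrite /square_sum.
have N1 : (2 ^ K)%:R * h K = 1 by rewrite -{1}(subn0 K) halfX_natr // expr0.
rewrite N1 !add0r.
(* The two radial edges are the same path and cancel, which leaves the outer sum minus the inner
   one. *)
have -> : rsum g (hedge Phi 0 1 K) (2 ^ K) = rsum g (hedge Phi 0 0 K) (2 ^ K).
  by apply: eq_rsum => k; rewrite /hedge /Phi cis0 cis1.
rewrite [rsum g (hedge Phi 0 0 K) _ + _]addrC addrK.
have inner : normc (rsum g (vedge Phi 0 0 K) (2 ^ K)) <= eta.
  have bnd k : (k < 2 ^ K)%N -> normc (g (vedge Phi 0 0 K k)) <= B.
    move=> _; apply: gB; rewrite /vedge /Phi /sig mulr0 addr0 addrAC subrr add0r.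
    rewrite normcM normc_real ger0_norm ?(ltW tau0) //.
    apply: (@le_lt_trans _ _ (r / 4 * 2)); last by clear -r0; lra.
    by apply: ler_pM; rewrite ?normc_ge0 ?(ltW tau0).
  have stp k : (k < 2 ^ K)%N -> normc (vedge Phi 0 0 K k.+1 - vedge Phi 0 0 K k) <= tau * (L * h K).
    move=> _; rewrite /vedge /Phi /sig mulr0 addr0 !add0r.
    set u := cis _; set v := cis _.
    have -> : a + tau%:C * (u - a) - (a + tau%:C * (v - a)) = tau%:C * (u - v) by ring.
    rewrite normcM normc_real ger0_norm ?(ltW tau0) // ler_pM2l //.
    apply: le_trans (lipschitz_cis _ _) _; rewrite ler_pM2l //.
    by rewrite -natr1 mulrDl mul1r addrAC subrr add0r ger0_norm // ltW ?halfX_gt0.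
  apply: le_trans (rsum_le bnd stp) _.
  have -> : (2 ^ K)%:R * (B * (tau * (L * h K))) = tau * (B * L) * ((2 ^ K)%:R * h K) by ring.
  by rewrite N1 mulr1 -ler_pdivlMr ?mulr_gt0.
(* On the unit circle the increments are z (omega - 1), so the sum is a multiple of an average. *)
have outer : rsum g (vedge Phi 1 0 K) (2 ^ K) =
   (2 ^ K)%:R * (omega R K - 1) * avg K (fun z => g z * z).
  rewrite /avg mulrAC mulVKf ?pow2C_neq0 // mulrC mulr_sumr; apply: eq_bigr => k _.
  rewrite /vedge /Phi /sig mulr1 subrKC mul1r !subrKC !add0r -!omegaX exprS.
  by ring.
rewrite outer => hle.
have : normc ((2 ^ K)%:R * (omega R K - 1) * avg K (fun z => g z * z)) <= eta + eta.
  rewrite -(subrK (rsum g (vedge Phi 0 0 K) (2 ^ K)) (_ * avg _ _)).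
  by apply: le_trans (le_normcD _ _) _; apply: lerD.
rewrite normcM [normc (_ * (omega _ _ - 1))]normcM normc_nat => hle2.
have : 2 * normc (avg K (fun z => g z * z)) <= eta + eta.
  apply: le_trans hle2; rewrite ler_wpM2r ?normc_ge0 //.
  (* The threshold [maxn 1 K0] ensures K > 0, as [omega_far] requires. *)
  by case: K K1 {K0K hle N1 inner outer} => // K _; exact: omega_far.
by rewrite -mulr2n -[eta *+ 2]mulr_natl ler_pM2l.
Qed.

End Entire.

(** * Taylor expansions *)

Section Taylor.
Variable R : realType.
Local Notation h n := ((2^-1 : R) ^+ n).
Implicit Types (f g : R[i] -> R[i]).

(** The approximate limit y may depend on e; this is the form in which [coef_cvg] meets the Cauchy
    criterion. *)
Lemma complex_cauchy_cvg (x : nat -> R[i]) :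
  (forall e : R, 0 < e -> exists y, \forall n \near \oo, normc (x n - y) <= e) ->
  exists l, forall e : R, 0 < e -> \forall n \near \oo, normc (x n - l) <= e.
Proof.
move=> hx.
have real_cvg (u : nat -> R) :
    (forall e : R, 0 < e -> exists y : R, \forall n \near \oo, `|u n - y| <= e) ->
    exists l : R, forall e : R, 0 < e -> \forall n \near \oo, `|u n - l| <= e.
  move=> hu; suff /cvg_ex [l /cvgrPdist_le hl] : cvgn u.
    by exists l => e e0; have := hl e e0; apply: filterS => n; rewrite distrC.
  apply/cauchy_cvgP; apply: cauchy_exP => e e0.
  have [y hy] := hu (e / 2) (divr_gt0 e0 (ltr0n _ 2)).
  exists y; apply: filterS hy => n hn; rewrite /= -ball_normE /= distrC.
  by apply: le_lt_trans hn _; rewrite ltr_pdivrMr // ltr_pMr // ltr1n.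
have [l1 h1] : exists l : R, forall e : R, 0 < e -> \forall n \near \oo, `|Re (x n) - l| <= e.
  apply: real_cvg => e /hx [y hy]; exists (Re y); apply: filterS hy => n.
  by apply: le_trans; rewrite -ReB normc_Re.
have [l2 h2] : exists l : R, forall e : R, 0 < e -> \forall n \near \oo, `|Im (x n) - l| <= e.
  apply: real_cvg => e /hx [y hy]; exists (Im y); apply: filterS hy => n.
  apply: le_trans; rewrite (_ : Im (x n) - Im y = Im (x n - y)) ?normc_Im //.
  by case: (x n) y => a b [].
exists (l1 +i* l2) => e e0.
have e2 : 0 < e / 2 by exact: divr_gt0.
apply: filterS2 (h1 _ e2) (h2 _ e2) => n a1 a2.
apply: le_trans (normc_le_ReIm _) _; rewrite [e]splitr; case: (x n) a1 a2 => a b /= a1 a2.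
exact: lerD.
Qed.

Lemma geometric_tail (x : R[i]) M : normc x <= 2^-1 ->
  normc ((1 - x)^-1 - \sum_(m < M) x ^+ m) <= 2 * normc x ^+ M.
Proof.
move=> x2.
have x1 : 2^-1 <= normc (1 - x).
  by have := ge_normcD 1 (- x); rewrite normcN normc1; apply: le_trans; lra.
have n0 : 1 - x != 0 by rewrite -normc_gt0 (lt_le_trans _ x1) // invr_gt0.
have -> : (1 - x)^-1 - \sum_(m < M) x ^+ m = x ^+ M / (1 - x).
  apply: (mulIf n0); rewrite divfK // mulrBl mulVf // mulrC.
  rewrite (_ : (1 - x) * _ = 1 - x ^+ M); first by ring.
  by rewrite -[LHS]opprK -mulNr opprB -subrX1 opprB.
rewrite normc_div normcX mulrC ler_wpM2r ?exprn_ge0 ?normc_ge0 //.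
by rewrite invf_ple ?posrE // (lt_le_trans _ x1) // invr_gt0.
Qed.

Lemma near_sum_cvg (x : nat -> nat -> R[i]) (c : nat -> R[i]) M :
  (forall m, (m < M)%N -> forall e : R, 0 < e -> \forall n \near \oo, normc (x n m - c m) <= e) ->
  forall a : R[i], normc a <= 1 -> forall e : R, 0 < e -> \forall n \near \oo,
    normc (\sum_(m < M) x n m * a ^+ m - \sum_(m < M) c m * a ^+ m) <= e.
Proof.
move=> hx a a1; elim: M hx => [|M IH] hx e e0.
  by apply: nearW => n; rewrite !big_ord0 subrr normc0 ltW.
have e2 : 0 < e / 2 by exact: divr_gt0.
have hM := hx M (ltnSn M) _ e2.
have hlt := IH (fun m mM => hx m (ltnW mM)) _ e2.
apply: filterS2 hM hlt => n h1 h2.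
rewrite !big_ord_recr /= opprD addrACA [e]splitr.
apply: le_trans (le_normcD _ _) _; apply: lerD => //.
rewrite -mulrBl normcM normcX; apply: le_trans h1.
by rewrite ler_piMr ?normc_ge0 // exprn_ile1 ?normc_ge0.
Qed.

Section UnitDisc.
Variables (f : R[i] -> R[i]) (B : R).
Hypothesis ef : entire f.
Hypothesis fB : forall K k, (k < 2 ^ K)%N -> normc (f (omega R K ^+ k)) <= B.

(** Discrete Cauchy integral for the Taylor coefficient of degree m, which is its limit as K
    grows. *)
Let coef K m := avg K (fun z => f z * z ^- m).

Let B0 : 0 <= B.
Proof. by apply: le_trans (@fB 0 0 isT); exact: normc_ge0. Qed.

Let coef_le K m : normc (coef K m) <= B.
Proof.
apply: avg_le => k kK; rewrite normcM normcV normcX normc_omegaX expr1n invr1 mulr1.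
exact: fB.
Qed.

Let divz_le (a : R[i]) K k : normc a <= 2^-1 -> normc (a / omega R K ^+ k) <= 2^-1.
Proof. by rewrite normc_div normc_omegaX divr1. Qed.

(** Write f z = (f z - f a) + f a. The first part is [cauchy_avg]; in the second, the geometric sum
    of a / z to order 2^K has average exactly 1 and its tail is negligible. *)
Let cauchy_formula a : normc a <= 2^-1 -> forall eta : R, 0 < eta ->
  \forall K \near \oo, normc (f a - avg K (fun z => f z * (1 - a / z)^-1)) <= eta.
Proof.
move=> a2 eta eta0.
have a1 : normc a < 1 by apply: le_lt_trans a2 _; rewrite invf_lt1 ?ltr1n.
have e2 : 0 < eta / 2 by exact: divr_gt0.
have fa1 : 0 < 2 * (normc (f a) + 1) by rewrite mulr_gt0 // ltr_wpDl ?normc_ge0.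
have [N hN] := halfX_small (divr_gt0 e2 fa1).
have hN' : \forall K \near \oo, h K < eta / 2 / (2 * (normc (f a) + 1)) by exists N.
apply: filterS2 (cauchy_avg ef a1 e2) hN' => K hK hKs.
have one : normc (avg K (fun z => (1 - a / z)^-1) - 1) <= 2 * h K.
  have e1 : avg K (fun z => \sum_(m < 2 ^ K) (a / z) ^+ m) = 1.
    rewrite (avg_sum K (2 ^ K) (fun m z => (a / z) ^+ m)).
    have N0 : (0 < 2 ^ K)%N by rewrite expn_gt0.
    rewrite (bigD1 (Ordinal N0)) //= (_ : avg K _ = 1); last first.
      rewrite -[RHS](avg_cst K); apply: eq_avg => k; by rewrite expr0.
    rewrite big1 ?addr0 // => i i0.
    transitivity (a ^+ i * avg K (fun z => z ^- i)).
      by rewrite -avgZ; apply: eq_avg => k; rewrite expr_div_n.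
    by rewrite avg_exprV ?mulr0 // ltn_ord andbT lt0n.
  rewrite -[X in normc (_ - X)]e1 -avgB; apply: avg_le => k _.
  apply: le_trans (geometric_tail _ (divz_le _ _ a2)) _.
  rewrite ler_pM2l // normc_div normc_omegaX divr1.
  apply: (@le_trans _ _ (2^-1 ^+ (2 ^ K))).
    by rewrite lerXn2r ?nnegrE ?normc_ge0 ?invr_ge0.
  by apply: halfX_le; apply: ltnW; exact: ltn_expl.
have e : avg K (fun z => f z * (1 - a / z)^-1) - f a =
    avg K (fun z => (f z - f a) / (z - a) * z) + f a * (avg K (fun z => (1 - a / z)^-1) - 1).
  rewrite mulrBr mulr1 -avgZ addrA -avgD; congr (_ - _); apply: eq_avg => k.
  set z := omega R K ^+ k.
  have z0 : z != 0 by exact: omegaX_neq0.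
  have za : z - a != 0.
    by rewrite subr_eq0; apply: contraTneq a1 => <-; rewrite /z normc_omegaX ltxx.
  have -> : (1 - a / z)^-1 = (z - a)^-1 * z by rewrite -{1}(divff z0) -mulrBl invfM invrK.
  by ring.
rewrite normcB e [eta]splitr; apply: le_trans (le_normcD _ _) _; apply: lerD => //.
rewrite normcM; apply: le_trans (ler_wpM2l (normc_ge0 _) one) _.
move: hKs; rewrite ltr_pdivlMr // => hKs; apply: le_trans (ltW hKs).
by have := halfX_gt0 R K; lra.
Qed.

Let expansion a M : normc a <= 2^-1 -> forall eta : R, 0 < eta -> \forall K \near \oo,
  normc (f a - \sum_(m < M) coef K m * a ^+ m) <= 2 * B * normc a ^+ M + eta.
Proof.
move=> a2 eta eta0; apply: filterS (cauchy_formula a2 eta0) => K hK.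
set A := avg _ _ in hK.
rewrite -(subrK A (f a)) -addrA addrC; apply: le_trans (le_normcD _ _) _.
apply: lerD => //.
have -> : \sum_(m < M) coef K m * a ^+ m = avg K (fun z => f z * \sum_(m < M) (a / z) ^+ m).
  under eq_bigr => m _ do rewrite mulrC /coef -avgZ.
  rewrite -(avg_sum K M (fun m z => a ^+ m * (f z * z ^- m))); apply: eq_avg => k.
  rewrite mulr_sumr; apply: eq_bigr => m _; rewrite expr_div_n; ring.
rewrite -avgB; apply: avg_le => k kK; rewrite -mulrBr normcM mulrAC mulrC.
apply: ler_pM; rewrite ?normc_ge0 ?fB //.
apply: le_trans (geometric_tail _ (divz_le _ _ a2)) _.
by rewrite normc_div normc_omegaX divr1.
Qed.

(* Once the previous coefficients converge, the expansion at a small t > 0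
   determines coef K m up to O(t) for large K, so it is a Cauchy sequence. *)
Let coef_cvg m : exists c, forall e : R, 0 < e ->
  \forall K \near \oo, normc (coef K m - c) <= e.
Proof.
elim/ltn_ind: m => m IH; apply: complex_cauchy_cvg => e e0.
have /choice [c hc] : forall j, exists c, (j < m)%N -> forall e : R, 0 < e ->
    \forall K \near \oo, normc (coef K j - c) <= e.
  by move=> j; have [/IH [c hc]|_] := boolP (j < m)%N; [exists c|exists 0].
have B1 : 0 < 4 * (B + 1) by rewrite mulr_gt0 // ltr_wpDl.
(* Makes the truncation error 2 B t^(m+1) at most (e / 2) t^m; the two limits below cost (e / 4) t^m
   each. *)
pose t := Num.min 2^-1 (e / (4 * (B + 1))).
have t0 : 0 < t by rewrite lt_min invr_gt0 ltr0n divr_gt0.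
have t2 : t <= 2^-1 by rewrite ge_min lexx.
have te : t * (4 * (B + 1)) <= e by rewrite -ler_pdivlMr // ge_min lexx orbT.
have nt : normc t%:C = t by rewrite normc_real ger0_norm // ltW.
have a2 : normc t%:C <= 2^-1 by rewrite nt.
have a1 : normc t%:C <= 1 by apply: le_trans a2 _; rewrite invf_le1 ?ler1n.
have tm0 : 0 < t ^+ m by rewrite exprn_gt0.
have e4 : 0 < e / 4 * t ^+ m by rewrite mulr_gt0 ?divr_gt0.
have h1 := expansion m.+1 a2 e4.
have h2 := near_sum_cvg hc a1 e4.
pose y := (f t%:C - \sum_(j < m) c j * t%:C ^+ j) / t%:C ^+ m.
exists y; apply: filterS2 h1 h2 => K.
rewrite nt big_ord_recr /=; set S := \sum_(i < m) coef _ _ * _; set S' := \sum_(i < m) _.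
move=> h1 h2.
have tC0 : t%:C ^+ m != 0 by rewrite expf_neq0 // -normc_gt0 nt.
rewrite -(ler_pM2r tm0).
have -> : normc (coef K m - y) * t ^+ m = normc ((coef K m - y) * t%:C ^+ m).
  by rewrite normcM normcX nt.
rewrite mulrBl divfK //.
have -> : coef K m * t%:C ^+ m - (f t%:C - S') =
   - (f t%:C - (S + coef K m * t%:C ^+ m)) - (S - S') by ring.
apply: le_trans (le_normcB _ _) _; rewrite normcN.
apply: le_trans (lerD h1 h2) _.
rewrite exprS; have -> : 2 * B * (t * t ^+ m) + e / 4 * t ^+ m + e / 4 * t ^+ m =
   (2 * B * t + e / 2) * t ^+ m by field.
rewrite ler_pM2r //; lra.
Qed.

Lemma taylor_unit : exists2 c : nat -> R[i], forall m, normc (c m) <= B &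
  forall a M, normc a <= 2^-1 ->
    normc (f a - \sum_(m < M) c m * a ^+ m) <= 2 * B * normc a ^+ M.
Proof.
have [c hc] := choice coef_cvg; exists c => [m|a M a2].
  apply/ler_addgt0Pr => e e0.
  have [K hK] := filter_ex (hc m e e0).
  rewrite -(subrK (coef K m) (c m)) addrC; apply: le_trans (le_normcD _ _) _.
  by apply: lerD; rewrite // normcB.
apply/ler_addgt0Pr => e e0.
have e2 : 0 < e / 2 by exact: divr_gt0.
have a1 : normc a <= 1 by apply: le_trans a2 _; rewrite invf_le1 ?ler1n.
have [K [h1 h2]] := filter_ex (filterI (expansion M a2 e2)
   (near_sum_cvg (fun m (_ : (m < M)%N) => hc m) a1 e2)).
set S := \sum_(m < M) coef _ _ * _ in h1 h2.
rewrite -(subrK S (f a)) -addrA [e]splitr [leRHS]addrA.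
by apply: le_trans (le_normcD _ _) _; apply: lerD.
Qed.

End UnitDisc.

Lemma taylor f c (r B : R) : entire f -> 0 < r ->
  (forall z, normc (z - c) <= r -> normc (f z) <= B) ->
  exists2 a : nat -> R[i], forall m, normc (a m) <= B &
  forall w M, normc w <= 2^-1 ->
    normc (f (c + r%:C * w) - \sum_(m < M) a m * w ^+ m) <= 2 * B * normc w ^+ M.
Proof.
move=> ef r0 fB; apply: taylor_unit; first exact: entire_affine.
move=> K k _; apply: fB; rewrite addrAC subrr add0r normcM normc_omegaX mulr1.
by rewrite normc_real ger0_norm // ltW.
Qed.

Lemma taylor_ex f c (r : R) : entire f -> 0 < r ->
  exists B (a : nat -> R[i]), [/\ 0 < B, forall m, normc (a m) <= B &
  forall w M, normc w <= 2^-1 ->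
    normc (f (c + r%:C * w) - \sum_(m < M) a m * w ^+ m) <= 2 * B * normc w ^+ M].
Proof.
move=> ef r0; have efa := @entire_affine R f c r%:C ef.
have [B B0 hB] := entire_bounded_circle efa.
have [a h1 h2] := taylor_unit efa (fun K k kK => hB K k (ltnW kK)).
by exists B, a.
Qed.

Lemma has_cderiv_unique f z d d' : has_cderiv f z d -> has_cderiv f z d' -> d = d'.
Proof. by move=> /cderiv_derivable [_ <-] /cderiv_derivable [_ <-]. Qed.

Lemma has_cderivB f g z d d' : has_cderiv f z d -> has_cderiv g z d' ->
  has_cderiv (fun w => f w - g w) z (d - d').
Proof.
move=> hf hg e e0; have e2 : 0 < e / 2 by exact: divr_gt0.
have [r r0 hr] := hf _ e2; have [s s0 hs] := hg _ e2.
exists (Num.min r s) => [|w]; first by rewrite lt_min r0.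
rewrite lt_min => /andP[/hr h1 /hs h2].
have -> : f w - g w - (f z - g z) - (d - d') * (w - z) =
  (f w - f z - d * (w - z)) - (g w - g z - d' * (w - z)) by ring.
by apply: le_trans (le_normcB _ _) _; rewrite [e]splitr mulrDl; apply: lerD.
Qed.

Lemma has_cderiv_quadratic (a b c z : R[i]) :
  has_cderiv (fun w => a + b * w + c * w ^+ 2) z (b + 2 * c * z).
Proof.
move=> e e0; have c1 : 0 < normc c + 1 by rewrite ltr_wpDl ?normc_ge0.
exists (e / (normc c + 1)) => [|w hw]; first exact: divr_gt0.
have -> : a + b * w + c * w ^+ 2 - (a + b * z + c * z ^+ 2) - (b + 2 * c * z) * (w - z)
  = c * (w - z) * (w - z) by ring.
rewrite normcM ler_wpM2r ?normc_ge0 // normcM.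
move: hw; rewrite ltr_pdivlMr // => /ltW; apply: le_trans.
by rewrite mulrC ler_wpM2l ?normc_ge0 // lerDl.
Qed.

Lemma has_cderiv_translate f c z d :
  has_cderiv f (c + z) d -> has_cderiv (fun w => f (c + w)) z d.
Proof.
move=> hf e /hf [r r0 hr]; exists r => // w hw.
have e1 : c + w - (c + z) = w - z by ring.
by have := hr (c + w); rewrite e1; apply.
Qed.

Lemma has_cderiv_le f z d (L : R) : has_cderiv f z d ->
  (exists2 r : R, 0 < r & forall w, normc (w - z) < r -> normc (f w - f z) <= L * normc (w - z)) ->
  normc d <= L.
Proof.
move=> hf [r r0 hr]; apply/ler_addgt0Pr => e e0.
have [s s0 hs] := hf e e0.
pose t := Num.min r s / 2.
have m0 : 0 < Num.min r s by rewrite lt_min r0.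
have t0 : 0 < t by exact: divr_gt0.
have : t < Num.min r s by rewrite ltr_pdivrMr // ltr_pMr // ltr1n.
rewrite lt_min => /andP[tr ts].
have nt : normc (z + t%:C - z) = t.
  by rewrite addrAC subrr add0r normc_real ger0_norm // ltW.
have := hr (z + t%:C); rewrite nt => /(_ tr) h1.
have := hs (z + t%:C); rewrite nt => /(_ ts) h2.
rewrite -(ler_pM2r t0) mulrDl -{1}nt -normcM.
set A := f _ - f z in h1 h2; set D := d * _ in h2 *.
by rewrite -[D](subKr A); apply: le_trans (le_normcB _ _) (lerD h1 h2).
Qed.

(** Truncated after its constant term, the Taylor expansion is a Lipschitz bound at c with constant
    2 B / r. *)
Lemma cauchy_estimate f c (r B : R) : entire f -> 0 < r ->
  (forall z, normc (z - c) <= r -> normc (f z) <= B) ->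
  normc (cderiv f c) * r <= 2 * B.
Proof.
move=> ef r0 fB; have [a ha hf] := taylor ef r0 fB.
rewrite -ler_pdivlMr //; apply: (has_cderiv_le (entire_cderiv c ef)).
have fc : f c = a 0%N.
  have := hf 0 1%N; rewrite normc0 mulr0 addr0 expr1 mulr0 big_ord1 expr0 mulr1.
  rewrite invr_ge0 ler0n => /(_ isT) h0; apply/eqP; rewrite -subr_eq0 -normc_eq0.
  by rewrite eq_le h0 normc_ge0.
exists (r / 2) => [|w hw]; first exact: divr_gt0.
have rC : r%:C != 0 by rewrite -normc_gt0 normc_real normr_gt0 gt_eqF.
have := hf ((w - c) / r%:C) 1%N.
have -> : r%:C * ((w - c) / r%:C) = w - c by rewrite mulrC divfK.
rewrite big_ord1 expr0 mulr1 subrKC fc expr1.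
rewrite normc_div normc_real (ger0_norm (ltW r0)) ler_pdivrMr // [2^-1 * r]mulrC.
by move=> /(_ (ltW hw)); rewrite mulrA mulrAC.
Qed.

(* Minus its quadratic Taylor polynomial at c, f is O(w^3); Cauchy's estimate on
   the disc of centre c + w and radius |w| makes the derivative O(w^2). *)
Lemma entire_cderiv_entire f : entire f -> entire (cderiv f).
Proof.
move=> ef; apply: has_cderiv_entire => c.
have [B [a [B0 _ hf0]]] := taylor_ex c ef ltr01.
have hf w M : normc w <= 2^-1 ->
    normc (f (c + w) - \sum_(m < M) a m * w ^+ m) <= 2 * B * normc w ^+ M.
  by move=> /hf0 => /(_ M); rewrite (_ : 1%:C * w = w) // mul1r.
have fc : f c = a 0%N.
  have := hf 0 1%N; rewrite normc0 addr0 expr1 mulr0 big_ord1 expr0 mulr1.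
  rewrite invr_ge0 ler0n => /(_ isT) h0; apply/eqP; rewrite -subr_eq0 -normc_eq0.
  by rewrite eq_le h0 normc_ge0.
have B2 : 0 < 32 * B by rewrite mulr_gt0.
have f1 : cderiv f c = a 1%N.
  apply: has_cderiv_unique (entire_cderiv c ef) _ => e e0.
  exists (Num.min 2^-1 (e / (32 * B))) => [|z].
    by rewrite lt_min invr_gt0 ltr0n divr_gt0.
  rewrite lt_min => /andP[z2]; rewrite ltr_pdivlMr // => ze.
  have := hf (z - c) 2%N (ltW z2); rewrite subrKC big_ord_recr big_ord1 /= expr0 mulr1 expr1 -fc.
  rewrite opprD addrA => hz; apply: le_trans hz _.
  rewrite expr2 mulrA ler_wpM2r ?normc_ge0 //; apply: le_trans (ltW ze).
  by rewrite mulrC ler_wpM2l ?normc_ge0 // ler_pM2r // ler_nat.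
pose p w := a 0%N + a 1%N * w + a 2%N * w ^+ 2.
pose g w := f (c + w) - p w.
have dg w : has_cderiv g w (cderiv f (c + w) - (a 1%N + 2 * a 2%N * w)).
  apply: has_cderivB; last exact: has_cderiv_quadratic.
  by apply: has_cderiv_translate; exact: entire_cderiv.
have eg : entire g by apply: has_cderiv_entire => w; eexists; exact: dg.
have gle w : normc w <= 2^-1 -> normc (g w) <= 2 * B * normc w ^+ 3.
  move=> w2; have := hf w 3%N w2.
  by rewrite !big_ord_recr big_ord0 /= add0r expr0 mulr1 expr1.
exists (2 * a 2%N) => e e0.
exists (Num.min 4^-1 (e / (32 * B))) => [|z].
  by rewrite lt_min invr_gt0 ltr0n divr_gt0.
rewrite lt_min => /andP[z4]; rewrite ltr_pdivlMr // => ze.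
have [->|zc] := eqVneq z c; first by rewrite !subrr mulr0 subrr normc0 mulr0.
have w0 : 0 < normc (z - c) by rewrite normc_gt0 subr_eq0.
have := dg (z - c); rewrite subrKC => dgz.
(* Here |v| <= 2 |z - c| <= 1/2, whence 16 = 2 * 2^3. *)
have gB v : normc (v - (z - c)) <= normc (z - c) -> normc (g v) <= 16 * B * normc (z - c) ^+ 3.
  move=> hv; have v2 : normc v <= 2 * normc (z - c).
    rewrite -(subrK (z - c) v) mulrDl mul1r; apply: le_trans (le_normcD _ _) _.
    by rewrite lerD2r.
  apply: le_trans (gle v _) _.
    by apply: le_trans v2 _; move: z4; clear; lra.
  have -> : 16 * B * normc (z - c) ^+ 3 = 2 * B * (2 * normc (z - c)) ^+ 3 by ring.
  by rewrite ler_wpM2l ?mulr_ge0 ?(ltW B0) // lerXn2r ?nnegrE ?mulr_ge0 ?normc_ge0.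
have := cauchy_estimate eg w0 gB.
rewrite (has_cderiv_unique (entire_cderiv (z - c) eg) dgz) f1.
have -> : cderiv f z - (a 1%N + 2 * a 2%N * (z - c)) =
   cderiv f z - a 1%N - 2 * a 2%N * (z - c) by ring.
move=> hz; rewrite -(ler_pM2r w0); apply: le_trans hz _.
have -> : 2 * (16 * B * normc (z - c) ^+ 3) =
   normc (z - c) * (32 * B) * normc (z - c) * normc (z - c) by ring.
by rewrite !ler_wpM2r ?normc_ge0 // ltW.
Qed.

End Taylor.

(** * Harmonic functions *)

Section Harmonic.
Variable R : realType.
Local Notation h n := ((2^-1 : R) ^+ n).
Implicit Types (f g : R[i] -> R[i]) (u v : R[i] -> R).

(* Harmonic functions are handled as real parts of power series converging
   geometrically on every disc; this holds for log |f| without a logarithm of f. *)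
Definition harmonic_expansion u (c : R[i]) (r : R) (a : nat -> R[i]) (K : R) :=
  forall w M, normc w <= 1 ->
    `|u (c + r%:C * w) - Re (\sum_(m < M) a m * w ^+ m)| <= K * h M.

Definition is_harmonic u := forall c (r : R), 0 < r ->
  exists a K, harmonic_expansion u c r a K.

Lemma harmonic_Re f : entire f -> is_harmonic (fun z => Re (f z)).
Proof.
(* Expanding on the disc of radius 2 r makes the error geometric, with ratio 1/2, on the whole disc
   of radius r. *)
move=> ef c r r0; have r2 : 0 < 2 * r by rewrite mulr_gt0.
have [B [a [B0 _ hf]]] := taylor_ex c ef r2.
exists (fun m => a m / 2 ^+ m), (2 * B) => w M w1.
have w2 : normc (w / 2) <= 2^-1.
  by rewrite normc_div (normc_nat _ 2) ler_pdivrMr // mulVf ?pnatr_eq0.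
have := hf (w / 2) M w2.
have -> : (2 * r)%:C * (w / 2) = r%:C * w.
  by rewrite rmorphM rmorph_nat; field.
rewrite (eq_bigr (fun m : 'I_M => a m / 2 ^+ m * w ^+ m)); last first.
  by move=> m _; rewrite expr_div_n mulrA mulrAC.
move=> hw; rewrite -ReB; apply: le_trans (normc_Re _) _; apply: le_trans hw _.
by rewrite ler_pM2l ?mulr_gt0 // lerXn2r ?nnegrE ?normc_ge0 ?invr_ge0.
Qed.

Lemma harmonicZ_affine u c (r s : R) : 0 < r -> is_harmonic u ->
  is_harmonic (fun z => s * u (c + r%:C * z)).
Proof.
move=> r0 hu d t t0; have rt : 0 < r * t by rewrite mulr_gt0.
have [a [K ha]] := hu (c + r%:C * d) _ rt.
exists (fun m => s%:C * a m), (`|s| * K) => w M w1.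
have -> : c + r%:C * (d + t%:C * w) = c + r%:C * d + (r * t)%:C * w.
  by rewrite rmorphM; ring.
under eq_bigr => m _ do rewrite -mulrA.
rewrite -mulr_sumr ReZ -mulrBr normrM -mulrA ler_wpM2l //.
exact: ha.
Qed.

Lemma harmonicB u v : is_harmonic u -> is_harmonic v -> is_harmonic (fun z => u z - v z).
Proof.
move=> hu hv c r r0; have [a [K ha]] := hu c r r0; have [b [L hb]] := hv c r r0.
exists (fun m => a m - b m), (K + L) => w M w1.
under eq_bigr => m _ do rewrite mulrBl.
rewrite sumrB ReB mulrDl.
apply: le_trans (lerD (ha w M w1) (hb w M w1)).
apply: le_trans (ler_normB _ _); rewrite le_eqVlt; apply/orP; left; apply/eqP.
by congr (`|_|); ring.
Qed.

(** Bisection of the segment. On a short interval containing s, the local estimate at s is applied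
    to both endpoints; their distances to s add up to the length of the interval. *)
Lemma mean_value_le u (z0 z1 : R[i]) (L : R) : 0 <= L ->
  (forall t, 0 <= t <= 1 -> forall e : R, 0 < e -> exists2 r : R, 0 < r &
    forall z, normc (z - (z0 + t%:C * (z1 - z0))) < r ->
      `|u z - u (z0 + t%:C * (z1 - z0))| <= (L + e) * normc (z - (z0 + t%:C * (z1 - z0)))) ->
  `|u z1 - u z0| <= L * normc (z1 - z0).
Proof.
move=> L0 hu; set D := normc (z1 - z0).
have D0 : 0 <= D by exact: normc_ge0.
pose p t := z0 + t%:C * (z1 - z0).
have dp s t : normc (p s - p t) = `|s - t| * D.
  have -> : p s - p t = (s - t)%:C * (z1 - z0) by rewrite /p rmorphB; ring.
  by rewrite normcM normc_real.
suff main e : 0 < e -> `|u z1 - u z0| <= (L + e) * D.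
  apply/ler_addgt0Pr => e e0; have D1 : 0 < D + 1 by rewrite ltr_wpDl.
  apply: le_trans (main _ (divr_gt0 e0 D1)) _; rewrite mulrDl lerD2l.
  by rewrite mulrAC ler_pdivrMr // ler_wpM2l ?(ltW e0) // lerDl.
move=> e0.
have := @cousin_square R (fun x y n => `|u (p (x + h n)) - u (p x)| <= (L + e) * (h n * D)).
rewrite add0r expr0 mul1r /p mul1r mul0r addr0 subrKC; apply.
- move=> x y n h1 h2 _ _.
  rewrite (halfX_split R n) addrA.
  have -> : forall b : R, (L + e) * ((b + b) * D) = (L + e) * (b * D) + (L + e) * (b * D).
    by move=> b; ring.
  exact: le_trans (ler_distD _ _ _) (lerD h2 h1).
- move=> s t s01 _; have [r r0 hr] := hu s s01 e e0.
  have D1 : 0 < D + 1 by rewrite ltr_wpDl.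
  have [N hN] := halfX_small (divr_gt0 r0 D1).
  exists N => n x y Nn x0 x1 _ _ xs _.
  have hn0 := halfX_gt0 R n.
  have close t' : x <= t' <= x + h n -> `|u (p t') - u (p s)| <= (L + e) * (`|t' - s| * D).
    move=> ht; rewrite -dp; apply: hr; rewrite dp.
    have := hN n Nn; rewrite ltr_pdivlMr // => hlt.
    apply: le_lt_trans hlt; apply: ler_pM => //; last by rewrite lerDl.
    exact: itv_dist ht xs.
  have hx : x <= x <= x + h n by rewrite lexx lerDl ltW.
  have hx' : x <= x + h n <= x + h n by rewrite lexx lerDl ltW.
  have /andP[xs1 xs2] := xs; have := lerD (close _ hx') (close _ hx).
  rewrite (ger0_norm (_ : 0 <= x + h n - s)) ?subr_ge0 // (distrC x s).
  rewrite (ger0_norm (_ : 0 <= s - x)) ?subr_ge0 // -mulrDr -mulrDl addrA subrK.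
  rewrite [x + _ - x]addrC addKr [`|u (p x) - _|]distrC => hle; apply: le_trans hle.
  exact: ler_distD.
Qed.

Lemma ln_le_sub1 (x : R) : 0 < x -> ln x <= x - 1.
Proof. by move=> x0; have := @le_ln1Dx R (x - 1); rewrite subrKC; apply; lra. Qed.

Lemma sqr_normc_1D (x : R[i]) : normc (1 + x) ^+ 2 = 1 + (2 * Re x + normc x ^+ 2).
Proof. by case: x => a b /=; rewrite !sqr_sqrtr ?addr_ge0 ?sqr_ge0 // add0r; ring. Qed.

(** With y = |1 + x|^2 - 1, use 1 - 1/(1 + y) <= ln (1 + y) <= y. The two bounds differ by y^2/(1 +
    y) <= 12 |x|^2, and ln |1 + x| is half of ln (1 + y). *)
Lemma ln_normc_1D (x : R[i]) : normc x <= 4^-1 ->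
  `|ln (normc (1 + x)) - Re x| <= 6 * normc x ^+ 2.
Proof.
move=> x4; have n0 := normc_ge0 x; have := normc_Re x; rewrite ler_norml => /andP[re1 re2].
set y := 2 * Re x + normc x ^+ 2.
have y1 : `|y| <= 9 / 4 * normc x.
  by rewrite ler_norml /y; apply/andP; split; nra.
have y2 : 7 / 16 <= 1 + y.
  by move: y1; rewrite ler_norml => /andP[y1 _]; lra.
have ypos : 0 < 1 + y by lra.
have npos : 0 < normc (1 + x).
  rewrite lt_def normc_ge0 andbT; apply: contraTneq ypos => e.
  by rewrite /y -sqr_normc_1D e expr0n ltxx.
have e : 2 * ln (normc (1 + x)) = ln (1 + y) by rewrite -sqr_normc_1D lnXn // mulr_natl.
have up := ln_le_sub1 ypos.
have ipos : 0 < (1 + y)^-1 by rewrite invr_gt0.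
have lo := ln_le_sub1 ipos; rewrite lnV ?posrE // in lo.
have i1 : (1 + y)^-1 * (1 + y) = 1 by rewrite mulVf ?gt_eqF.
have i2 : (1 + y)^-1 <= 16 / 7.
  by rewrite -[leRHS]invrK lef_pV2 ?posrE ?invr_gt0 ?divr_gt0 // invf_div.
have yy : y ^+ 2 <= 81 / 16 * normc x ^+ 2.
  rewrite -[y ^+ 2]real_normK ?num_real //.
  have -> : 81 / 16 * normc x ^+ 2 = (9 / 4 * normc x) ^+ 2 by field.
  by rewrite lerXn2r ?nnegrE ?mulr_ge0 ?divr_ge0.
have yi : y ^+ 2 * (1 + y)^-1 <= 12 * normc x ^+ 2.
  apply: (@le_trans _ _ (81 / 16 * normc x ^+ 2 * (16 / 7))).
    by apply: ler_pM => //; [exact: sqr_ge0|exact: ltW].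
  by have := sqr_ge0 (normc x); lra.
have yeq : y ^+ 2 * (1 + y)^-1 = y - 1 + (1 + y)^-1.
  apply: (mulIf (_ : 1 + y != 0)); first by rewrite gt_eqF.
  by rewrite -mulrA i1 mulrDl i1; ring.
have ydef : y = 2 * Re x + normc x ^+ 2 by [].
have sq := sqr_ge0 (normc x).
by rewrite ler_norml; apply/andP; split; lra.
Qed.

Lemma log_local f z : entire f -> f z != 0 -> forall e : R, 0 < e ->
  exists2 r : R, 0 < r & forall w, normc (w - z) < r ->
   `|ln (normc (f w)) - ln (normc (f z)) - Re (cderiv f z / f z * (w - z))|
     <= e * normc (w - z).
Proof.
move=> ef fz0 e e0; set d := cderiv f z.
have nz : 0 < normc (f z) by rewrite normc_gt0.
set N := normc (f z) in nz *.
have [r1 r10 h1] := has_cderiv_bound (entire_cderiv z ef).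
rewrite -/d in h1; set C := normc d + 1 in h1.
have C0 : 0 < C by rewrite ltr_wpDl ?normc_ge0.
have eN : 0 < e / 2 * N by rewrite mulr_gt0 ?divr_gt0.
have [r2 r20 h2] := entire_cderiv z ef eN.
(* With x the relative increment of f, [r3] gives |x| <= 1/4 and [r4] gives 6 |x|^2 <= (e / 2) |w -
   z|. *)
pose r3 := N / (4 * C); pose r4 := e * N ^+ 2 / (12 * C ^+ 2).
have C2 : 0 < 12 * C ^+ 2 by rewrite mulr_gt0 ?exprn_gt0.
have r30 : 0 < r3 by rewrite divr_gt0 ?mulr_gt0.
have r40 : 0 < r4 by rewrite divr_gt0 ?mulr_gt0 ?exprn_gt0.
exists (Num.min (Num.min r1 r2) (Num.min r3 r4)) => [|w]; first by rewrite !lt_min r10 r20 r30.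
rewrite !lt_min => /andP[/andP[/h1 {}h1 /h2 {}h2] /andP[h3 h4]].
set t := normc (w - z) in h1 h2 h3 h4 *; have t0 : 0 <= t by exact: normc_ge0.
pose x := (f w - f z) / f z.
have nx : normc x <= C * t / N by rewrite normc_div ler_pM2r ?invr_gt0.
have x4 : normc x <= 4^-1.
  apply: le_trans nx _; rewrite ler_pdivrMr //.
  by move: h3; rewrite /r3 ltr_pdivlMr ?mulr_gt0 //; lra.
have fw : f w = f z * (1 + x) by rewrite /x mulrDr mulr1 mulrC divfK // subrKC.
have x1 : 0 < normc (1 + x).
  have := ge_normcD 1 x; rewrite normc1; apply: lt_le_trans; lra.
have -> : ln (normc (f w)) = ln N + ln (normc (1 + x)).
  by rewrite fw normcM lnM ?posrE.
rewrite [ln N + _]addrC addrK.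
apply: (@le_trans _ _ (6 * normc x ^+ 2 + normc (x - d / f z * (w - z)))).
  apply: le_trans (lerD (ln_normc_1D x4) (normc_Re _)).
  by apply: le_trans (ler_normD _ _); rewrite ReB addrA subrK.
have -> : x - d / f z * (w - z) = (f w - f z - d * (w - z)) / f z.
  by rewrite /x; field.
rewrite normc_div -/N (_ : e * t = e / 2 * t + e / 2 * t); last by field.
apply: lerD.
  apply: (@le_trans _ _ (6 * (C * t / N) ^+ 2)).
    have X0 : 0 <= C * t / N by apply: le_trans nx; exact: normc_ge0.
    by rewrite ler_pM2l // lerXn2r ?nnegrE ?normc_ge0.
  move: h4; rewrite /r4 ltr_pdivlMr // => h4.
  rewrite expr_div_n exprMn mulrA ler_pdivrMr ?exprn_gt0 //.
  have -> : 6 * (C ^+ 2 * t ^+ 2) = (t * (12 * C ^+ 2)) * (t / 2) by field.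
  have -> : e / 2 * t * N ^+ 2 = e * N ^+ 2 * (t / 2) by field.
  by apply: ler_wpM2r; rewrite ?divr_ge0 // ltW.
by rewrite ler_pdivrMr // mulrAC.
Qed.

Lemma has_cderivD f g z d d' : has_cderiv f z d -> has_cderiv g z d' ->
  has_cderiv (fun w => f w + g w) z (d + d').
Proof.
move=> hf hg e e0; have e2 : 0 < e / 2 by exact: divr_gt0.
have [r r0 hr] := hf _ e2; have [s s0 hs] := hg _ e2.
exists (Num.min r s) => [|w]; first by rewrite lt_min r0.
rewrite lt_min => /andP[/hr h1 /hs h2].
have -> : f w + g w - (f z + g z) - (d + d') * (w - z) =
  (f w - f z - d * (w - z)) + (g w - g z - d' * (w - z)) by ring.
by apply: le_trans (le_normcD _ _) _; rewrite [e]splitr mulrDl; apply: lerD.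
Qed.

Lemma has_cderiv_cst (k z : R[i]) : has_cderiv (fun=> k) z 0.
Proof.
move=> e e0; exists 1 => // w _.
by rewrite subrr sub0r mul0r oppr0 normc0 mulr_ge0 ?normc_ge0 ?ltW.
Qed.

Lemma has_cderiv_monomial (k c z : R[i]) n :
  has_cderiv (fun w => k * (w - c) ^+ n) z (k * (n%:R * (z - c) ^+ n.-1)).
Proof.
have hX : has_cderiv (fun w => w ^+ n) (z - c) (n%:R * (z - c) ^+ n.-1).
  have := @derivable_cderiv R (fun w => w ^+ n) (z - c) (@exprn_derivable _ n _ _).
  by rewrite exp_derive [_%:A]mulr1.
move=> e e0; have k1 : 0 < normc k + 1 by rewrite ltr_wpDl ?normc_ge0.
have [r r0 hr] := hX _ (divr_gt0 e0 k1); exists r => // w hw.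
have e1 : w - c - (z - c) = w - z by ring.
have := hr (w - c); rewrite e1 => /(_ hw) {}hr.
rewrite -mulrBr -mulrA -mulrBr normcM.
apply: le_trans (ler_wpM2l (normc_ge0 k) hr) _.
rewrite mulrA ler_wpM2r ?normc_ge0 // mulrCA ler_piMr ?(ltW e0) //.
by rewrite ler_pdivrMr // mul1r lerDl.
Qed.

Lemma has_cderiv_poly (k : nat -> R[i]) c z M :
  has_cderiv (fun w => \sum_(m < M) k m * (w - c) ^+ m.+1) z
    (\sum_(m < M) k m * (m.+1%:R * (z - c) ^+ m)).
Proof.
elim: M => [|M IH].
  rewrite big_ord0 (_ : (fun w => _) = fun=> 0); first exact: has_cderiv_cst.
  by apply/funext => w; rewrite big_ord0.
rewrite big_ord_recr (_ : (fun w => _) =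
   fun w => \sum_(m < M) k m * (w - c) ^+ m.+1 + k M * (w - c) ^+ M.+1).
  by apply: has_cderivD => //; exact: has_cderiv_monomial.
by apply/funext => w; rewrite big_ord_recr.
Qed.

(* The derivative of log |f| is Re (f' / f dz); the primitive P of a Taylor
   polynomial of f' / f approximates it by the mean value inequality. *)
Lemma harmonic_log f : entire f -> (forall z, f z != 0) ->
  is_harmonic (fun z => ln (normc (f z))).
Proof.
move=> ef f0 c r r0; pose u z := ln (normc (f z)).
suff : exists a K, harmonic_expansion u c r a K by [].
pose q z := cderiv f z / f z.
have eq : entire q.
  move=> z; apply: (@derivableM _ _ (cderiv f : R[i]^o -> R[i]^o)
    (fun z : R[i]^o => (f z)^-1 : R[i]^o)).
    exact: entire_cderiv_entire.
  by apply: (@derivableV _ _ (f : R[i]^o -> R[i]^o)); [exact: f0|exact: ef].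
have r2 : 0 < 2 * r by rewrite mulr_gt0.
have r2C : (2 * r)%:C != 0 by rewrite -normc_gt0 normc_real normr_gt0 gt_eqF.
have [B [b [B0 _ hq]]] := taylor_ex c eq r2.
(* The coefficients [b] belong to the variable (z - c) / (2 r); integration in z - c divides by m +
   1. *)
pose k m := b m / ((2 * r)%:C ^+ m * m.+1%:R).
pose P M z := \sum_(m < M) k m * (z - c) ^+ m.+1.
pose P' M z := \sum_(m < M) k m * (m.+1%:R * (z - c) ^+ m).
have key w M : normc w <= 1 ->
    `|u (c + r%:C * w) - u c - Re (P M (c + r%:C * w))| <= 2 * B * r * h M.
  move=> w1.
  have L0 : 0 <= 2 * B * h M by rewrite !mulr_ge0 ?(ltW B0) ?ltW ?halfX_gt0.
  have Pc : P M c = 0 by rewrite /P big1 // => m _; rewrite subrr expr0n mulr0.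
  have := @mean_value_le (fun z => u z - Re (P M z)) c (c + r%:C * w) _ L0.
  rewrite Pc subr0 [c + _ - c]addrAC subrr add0r normcM normc_real (ger0_norm (ltW r0)).
  move=> H; rewrite addrAC; apply: le_trans (H _) _; last first.
    have -> : 2 * B * r * h M = 2 * B * h M * r by ring.
    by rewrite ler_wpM2l // ler_piMr ?(ltW r0).
  move=> t t01 e e0; set z := c + t%:C * (r%:C * w).
  have e2 : 0 < e / 2 by exact: divr_gt0.
  have [r1 r10 h1] := log_local ef (f0 z) e2.
  have [s1 s10 h2] := has_cderiv_poly k c z M e2.
  exists (Num.min r1 s1) => [|z']; first by rewrite lt_min r10.
  rewrite lt_min => /andP[/h1 {}h1 /h2 {}h2].
  rewrite -/(P M z') -/(P M z) -/(P' M z) in h2; rewrite -/(q z) -/(u z) -/(u z') in h1.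
  have hd : normc (q z - P' M z) <= 2 * B * h M.
    have v2 : normc (t%:C * w / 2) <= 2^-1.
      rewrite normc_div (normc_nat _ 2) ler_pdivrMr // mulVf ?pnatr_eq0 //.
      rewrite normcM normc_real; case/andP: t01 => t0 t1.
      by rewrite ger0_norm // mulr_ile1 ?normc_ge0.
    have := hq _ M v2.
    have -> : (2 * r)%:C * (t%:C * w / 2) = t%:C * (r%:C * w).
      by rewrite rmorphM rmorph_nat; field.
    rewrite -/z (eq_bigr (fun m : 'I_M => k m * (m.+1%:R * (z - c) ^+ m))); last first.
      move=> m _; rewrite /k /z [c + _]addrC addrK.
      have -> : t%:C * w / 2 = (t%:C * (r%:C * w)) / (2 * r)%:C.
        by apply: (mulIf r2C); rewrite divfK // rmorphM rmorph_nat; field.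
      rewrite expr_div_n; field.
      by rewrite expf_neq0 // nat1r pnatr_eq0.
    move=> hle; apply: le_trans hle _.
    by rewrite ler_wpM2l ?mulr_ge0 ?(ltW B0) // lerXn2r ?nnegrE ?normc_ge0 ?invr_ge0.
  set D := z' - z in h1 h2 *.
  have -> : u z' - Re (P M z') - (u z - Re (P M z)) =
      (u z' - u z - Re (q z * D)) - Re (P M z' - P M z - P' M z * D) + Re ((q z - P' M z) * D).
    by rewrite !ReB mulrBl ReB; ring.
  rewrite [leRHS]mulrDl [leRHS]addrC; apply: le_trans (ler_normD _ _) _; apply: lerD.
    rewrite (_ : e * _ = e / 2 * normc D + e / 2 * normc D); last by field.
    apply: le_trans (ler_normB _ _) _; apply: lerD => //.
    exact: le_trans (normc_Re _) h2.
  by apply: le_trans (normc_Re _) _; rewrite normcM ler_wpM2r ?normc_ge0.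
(* Integration shifts degrees by one, so M + 1 terms of the expansion use M terms of q: this doubles
   the constant 2 B r. The summand |u c| covers the empty expansion. *)
exists (fun j => if j is m.+1 then k m * r%:C ^+ m.+1 else (u c)%:C), (4 * B * r + `|u c|).
move=> w [|M] w1.
  rewrite big_ord0 subr0 expr0 mulr1.
  have := key w 0%N w1; rewrite /P big_ord0 subr0 expr0 mulr1 => hk.
  rewrite -(subrK (u c) (u _)); apply: le_trans (ler_normD _ _) _; rewrite lerD2r.
  by apply: le_trans hk _; rewrite !ler_pM2r // ler_nat.
rewrite big_ord_recl /= expr0 mulr1 ReD opprD addrA.
have -> : \sum_(i < M) k i * r%:C ^+ i.+1 * w ^+ i.+1 = P M (c + r%:C * w).
  by apply: eq_bigr => m _; rewrite [c + _]addrC addrK exprMn mulrA.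
apply: le_trans (key w M w1) _.
rewrite exprS [leRHS]mulrDl.
have -> : 4 * B * r * (2^-1 * h M) = 2 * B * r * h M by field.
by rewrite lerDl mulr_ge0 // -exprS ltW // halfX_gt0.
Qed.

End Harmonic.

(** * Harnack's inequality *)

Section Coefficients.
Variable R : realType.
Local Notation h n := ((2^-1 : R) ^+ n).
Implicit Types (u : R[i] -> R).

Lemma avg_monomial K i j : (i < 2 ^ K)%N -> (j < 2 ^ K)%N ->
  avg K (fun z => z ^+ i * z ^- j) = (i == j)%:R :> R[i].
Proof.
move=> iK jK; have [ij|ji|<-] := ltngtP i j.
- rewrite -[RHS](@avg_exprV R K (j - i)) ?subn_gt0 ?ij ?(leq_ltn_trans (leq_subr _ _)) //.
  apply: eq_avg => k; have := omegaX_neq0 R K k; set z := _ ^+ k => z0.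
  rewrite (_ : z ^+ j = z ^+ i * z ^+ (j - i)); last by rewrite -exprD subnKC // ltnW.
  have z1 : z ^+ i != 0 by exact: expf_neq0.
  by rewrite [X in _ * X]invfM mulrA (divff z1) mul1r.
- rewrite -[RHS](@avg_expr R K (i - j)) ?subn_gt0 ?ji ?(leq_ltn_trans (leq_subr _ _)) //.
  apply: eq_avg => k; have := omegaX_neq0 R K k; set z := _ ^+ k => z0.
  rewrite (_ : z ^+ i = z ^+ (i - j) * z ^+ j); last by rewrite -exprD subnK // ltnW.
  have z1 : z ^+ j != 0 by exact: expf_neq0.
  by rewrite -mulrA (divff z1) mulr1.
- rewrite -[RHS](avg_cst K); apply: eq_avg => k.
  by rewrite mulfV // expf_neq0 // omegaX_neq0.
Qed.

Lemma conjc_unit (z : R[i]) : normc z = 1 -> z^*%C = z^-1.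
Proof. by move=> z1; rewrite invc_norm -normc_normr z1 expr1n invr1 mul1r. Qed.

Lemma Re_avg_ge K (F : R[i] -> R[i]) (B : R) :
  (forall z, normc z = 1 -> B <= Re (F z)) -> B <= Re (avg K F).
Proof.
move=> hF; rewrite /avg.
have -> : (2 ^ K)%:R^-1 = ((2 ^ K)%:R^-1 : R)%:C by rewrite fmorphV rmorph_nat.
rewrite ReZ Re_sum ler_pdivlMl ?ltr0n ?expn_gt0 //.
rewrite -[(2 ^ K)%N in leLHS]card_ord -sum1_card natr_sum mulr_suml.
by apply: ler_sum => k _; rewrite mul1r hF // normc_omegaX.
Qed.

Lemma le_norm1 (x : R) : x <= `|x| + 1.
Proof. by rewrite ler_wpDr // ler_norm. Qed.

Lemma expansion_center u c r a K : harmonic_expansion u c r a K -> Re (a 0%N) = u c.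
Proof.
move=> ha; apply/eqP; rewrite eq_sym -subr_eq0 -normr_le0.
apply/ler_addgt0Pr => e e0; rewrite add0r.
have K1 : 0 < `|K| + 1 by rewrite ltr_wpDl.
have [N hN] := halfX_small (divr_gt0 e0 K1).
have := ha 0 N.+1; rewrite normc0 ler01 mulr0 addr0 => /(_ isT).
rewrite big_ord_recl expr0 mulr1 big1 ?addr0; last by move=> i _; rewrite expr0n mulr0.
move=> hle; apply: le_trans hle _.
have := hN N.+1 (leqnSn N); rewrite ltr_pdivlMr // => /ltW; apply: le_trans.
by rewrite mulrC; apply: ler_wpM2l; [exact/ltW/halfX_gt0|exact: le_norm1].
Qed.

(* The mean of the nonnegative functions (A - u) (1 + Re (mu z^m)), |mu| = 1,
   over the circle is A - u c - Re (conj mu * a_m) / 2. *)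
Lemma expansion_coef_le u c r a K (A : R) m : 0 <= r -> harmonic_expansion u c r a K ->
  (forall z, normc (z - c) <= r -> u z <= A) -> (0 < m)%N ->
  normc (a m) <= 2 * (A - u c).
Proof.
move=> r0 ha hA m0; rewrite -(expansion_center ha).
have [->|am0] := eqVneq (a m) 0.
  rewrite normc0 mulr_ge0 // subr_ge0 (expansion_center ha) hA // subrr normc0 //.
have nam : 0 < normc (a m) by rewrite normc_gt0.
apply/ler_addgt0Pr => e e0.
have K1 : 0 < 4 * (`|K| + 1) by rewrite mulr_gt0 // ltr_wpDl.
have [N hN] := halfX_small (divr_gt0 e0 K1).
pose M := maxn N m.+1.
have mM : (m < M)%N by rewrite leq_max leqnn orbT.
have KM : 4 * (K * h M) <= e.
  have := hN M (leq_maxl _ _); rewrite ltr_pdivlMr // => /ltW; apply: le_trans.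
  rewrite mulrA mulrC; apply: ler_wpM2l; first exact/ltW/halfX_gt0.
  by rewrite ler_wpM2l // le_norm1.
(* [mu] is the phase of a_m and [nu] its conjugate, so nu a_m = |a_m|. On the unit circle the second
   factor of [G] below is 1 + Re (mu z^m), between 0 and 2. *)
pose mu := a m / (normc (a m))%:C; pose nu := mu^-1.
have nC : (normc (a m))%:C != 0 by rewrite -normc_gt0 normc_real normr_gt0 gt_eqF.
have mu1 : normc mu = 1.
  by rewrite normc_div normc_real ger0_norm ?normc_ge0 // divff // gt_eqF.
have nu_am : nu * a m = (normc (a m))%:C.
  by rewrite /nu /mu invf_div mulrAC -mulrA divff // mulr1.
pose V z := \sum_(j < M) a j * z ^+ j.
pose G z := (A%:C - V z) * (1 + mu / 2 * z ^+ m + nu / 2 * z ^- m).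
have leG z : normc z = 1 -> - (2 * (K * h M)) <= Re (G z).
  move=> z1; set Y := mu * z ^+ m.
  have Y1 : normc Y = 1 by rewrite normcM normcX mu1 z1 expr1n mulr1.
  have -> : G z = (1 + Re Y)%:C * (A%:C - V z).
    rewrite /G mulrC; congr (_ * _).
    have -> : nu / 2 * z ^- m = Y^*%C / 2.
      by rewrite conjc_unit // /Y invfM -/nu mulrAC.
    have -> : mu / 2 * z ^+ m = Y / 2 by rewrite mulrAC.
    by rewrite -addrA -mulrDl addcJ mulrC mulKf ?pnatr_eq0 // rmorphD.
  rewrite ReZ ReB /=.
  have hY0 : 0 <= 1 + Re Y by have := normc_Re Y; rewrite Y1 ler_norml; lra.
  have hY2 : 1 + Re Y <= 2 by have := Re_le_normc Y; rewrite Y1; lra.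
  have : normc z <= 1 by rewrite z1.
  move=> /(ha z M); rewrite ler_norml => /andP[_ h2].
  have h1 : u (c + r%:C * z) <= A.
    by apply: hA; rewrite [c + _]addrC addrK normcM normc_real z1 mulr1 ger0_norm.
  have KM0 : 0 <= K * h M.
    have := ha 0 M; rewrite normc0 ler01 => /(_ isT); exact: le_trans.
  have h3 : - (K * h M) <= A - Re (V z).
    have := ha z M; rewrite z1 lexx ler_norml => /(_ isT) /andP[h4 _].
    by rewrite -/(V z) in h4; lra.
  have [A1|A1] := leP 0 (A - Re (V z)).
    by apply: (@le_trans _ _ 0); [rewrite oppr_le0 mulr_ge0|exact: mulr_ge0].
  have : (1 + Re Y) * - (A - Re (V z)) <= 2 * (K * h M).
    by apply: ler_pM => //; lra.
  by rewrite mulrN; lra.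
(* All exponents stay below 2^K0, so distinct monomials remain orthogonal for the discrete
   average. *)
have [K0 hK0] : exists K0, (M + m < 2 ^ K0)%N by exists (M + m)%N; exact: ltn_expl.
have avgG : avg K0 G = A%:C - (a 0%N + nu * a m / 2).
  pose T i z : R[i] := z ^+ i * (1 + mu / 2 * z ^+ m + nu / 2 * z ^- m).
  have avgT i : (i < M)%N -> avg K0 (T i) = (i == 0%N)%:R + nu / 2 * (i == m)%:R.
    move=> iM.
    transitivity (avg K0 (fun z => z ^+ i * z ^- 0)
        + mu / 2 * avg K0 (fun z => z ^+ (i + m) * z ^- 0)
        + nu / 2 * avg K0 (fun z => z ^+ i * z ^- m)).
      rewrite -!avgZ -!avgD; apply: eq_avg => k; rewrite /T expr0 invr1 !mulr1 exprD.
      by ring.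
    rewrite !avg_monomial ?expn_gt0 //; [|lia..].
    by rewrite addn_eq0 (gtn_eqF m0) andbF mulr0 addr0.
  transitivity (A%:C * avg K0 (T 0%N) - \sum_(j < M) a j * avg K0 (T j)).
    have -> : \sum_(j < M) a j * avg K0 (T j) = avg K0 (fun z => \sum_(j < M) a j * T j z).
      rewrite (avg_sum K0 M (fun j z => a j * T j z)); apply: eq_bigr => j _.
      by rewrite avgZ.
    rewrite -avgZ -avgB; apply: eq_avg => k; rewrite /G /T /V expr0 mul1r mulrBl mulr_suml.
    by congr (_ - _); apply: eq_bigr => j _; rewrite mulrA.
  rewrite avgT ?(leq_ltn_trans _ mM) // eqxx (_ : (0 == m)%N = false) ?mulr0 ?addr0 ?mulr1;
    last by rewrite ltn_eqF.
  congr (_ - _).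
  under eq_bigr => j _ do rewrite avgT ?ltn_ord // mulrDr.
  rewrite big_split /=; congr (_ + _).
    rewrite (bigD1 (Ordinal (leq_ltn_trans (leq0n m) mM))) //= mulr1 big1 ?addr0 // => j j0.
    by rewrite (_ : (nat_of_ord j == 0)%N = false) ?mulr0 //; apply: negbTE.
  rewrite (bigD1 (Ordinal mM)) //= eqxx mulr1 big1 ?addr0; last first.
    move=> j jm; rewrite (_ : (nat_of_ord j == m)%N = false) ?mulr0 //.
    by apply: negbTE.
  by rewrite mulrCA mulrA.
have := Re_avg_ge K0 leG; rewrite avgG nu_am ReB ReD.
rewrite [Re A%:C]/=.
have -> : Re ((normc (a m))%:C / 2) = normc (a m) / 2.
  by rewrite mulrC (_ : 2^-1 = (2^-1 : R)%:C) ?ReZ 1?mulrC // fmorphV rmorph_nat.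
by lra.
Qed.

Lemma sum_halfX_le1 M : \sum_(m < M) h m.+1 <= 1.
Proof.
suff -> : \sum_(m < M) h m.+1 = 1 - h M by rewrite gerBl ltW ?halfX_gt0.
elim: M => [|M IH]; first by rewrite big_ord0 expr0 subrr.
by rewrite big_ord_recr /= IH (halfX_split R M); ring.
Qed.

Lemma expansion_near u c r a K w (D : R) : harmonic_expansion u c r a K ->
  normc w <= 1 -> 0 <= D ->
  (forall m, normc (a m.+1) * normc w ^+ m.+1 <= D * h m.+1) ->
  `|u (c + r%:C * w) - u c| <= D.
Proof.
move=> ha w1 D0 hD; apply/ler_addgt0Pr => e e0.
have K1 : 0 < `|K| + 1 by rewrite ltr_wpDl.
have [N hN] := halfX_small (divr_gt0 e0 K1).
have KM : K * h N.+1 <= e.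
  have := hN N.+1 (leqnSn N); rewrite ltr_pdivlMr // => /ltW; apply: le_trans.
  by rewrite mulrC; apply: ler_wpM2l; [exact/ltW/halfX_gt0|exact: le_norm1].
have := ha w N.+1 w1; rewrite big_ord_recl expr0 mulr1 ReD (expansion_center ha).
set S := \sum_(i < N) _ => hle.
have hS : `|Re S| <= D.
  apply: le_trans (normc_Re _) _; apply: le_trans (normc_sum _ _ _) _.
  apply: (@le_trans _ _ (\sum_(i < N) D * h i.+1)).
    by apply: ler_sum => i _; rewrite normcM normcX lift0.
  by rewrite -mulr_sumr ler_piMr // sum_halfX_le1.
rewrite -(subrK (Re S) (_ - u c)); apply: le_trans (ler_normD _ _) _.
rewrite addrC; apply: lerD => //; apply: le_trans KM.
by rewrite -addrA -opprD.
Qed.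

Lemma disc_coord (c z : R[i]) (r t : R) : 0 < r -> normc (z - c) <= t * r ->
  exists2 w, z = c + r%:C * w & normc w <= t.
Proof.
move=> r0 hz; have rC : r%:C != 0 by rewrite -normc_gt0 normc_real normr_gt0 gt_eqF.
exists ((z - c) / r%:C); first by rewrite mulrC divfK // subrKC.
by rewrite normc_div normc_real (ger0_norm (ltW r0)) ler_pdivrMr.
Qed.

(** The form of Harnack's inequality used from here on: an upper bound alone controls the
    oscillation. The term of degree m + 1 is at most 2 (A - u c) t 2^-m, and these sum to 4 t (A - u
    c). *)
Lemma harmonic_near_center u c (r t A : R) z : is_harmonic u -> 0 < r -> 0 <= t <= 2^-1 ->
  (forall w, normc (w - c) <= r -> u w <= A) ->
  normc (z - c) <= t * r -> `|u z - u c| <= 4 * t * (A - u c).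
Proof.
move=> hu r0 /andP[t0 t2] hA hz.
have [a [K ha]] := hu c r r0.
have D0 : 0 <= A - u c by rewrite subr_ge0 hA // subrr normc0 ltW.
have [w -> wt] := disc_coord r0 hz.
have w1 : normc w <= 1 by apply: le_trans wt _; apply: le_trans t2 _; rewrite invf_le1 ?ler1n.
apply: (expansion_near ha w1) => [|m]; first by rewrite !mulr_ge0.
apply: (@le_trans _ _ (2 * (A - u c) * (t * h m))).
  apply: ler_pM; rewrite ?normc_ge0 ?exprn_ge0 ?normc_ge0 //.
    by apply: expansion_coef_le ha hA _; first exact: ltW.
  rewrite exprS; apply: ler_pM; rewrite ?exprn_ge0 ?normc_ge0 // lerXn2r ?nnegrE ?normc_ge0 //.
  exact: le_trans t2.
by rewrite exprS le_eqVlt; apply/orP; left; apply/eqP; field.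
Qed.

(** Apply [harmonic_near_center] at 0 on a disc so large that z has small relative distance t from
    its centre. *)
Lemma harmonic_liouville u (A : R) : is_harmonic u -> (forall z, u z <= A) ->
  forall z, u z = u 0.
Proof.
move=> hu hA z; apply/eqP; rewrite -subr_eq0 -normr_le0.
apply/ler_addgt0Pr => e e0; rewrite add0r.
have D0 : 0 <= A - u 0 by rewrite subr_ge0.
have D1 : 0 < 4 * (A - u 0 + 1) by rewrite mulr_gt0 // ltr_wpDl.
pose t := Num.min 2^-1 (e / (4 * (A - u 0 + 1))).
have t0 : 0 < t by rewrite lt_min invr_gt0 ltr0n divr_gt0.
have t2 : t <= 2^-1 by rewrite ge_min lexx.
have te : t * (4 * (A - u 0 + 1)) <= e by rewrite -ler_pdivlMr // ge_min lexx orbT.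
have r0 : 0 < (normc z + 1) / t by rewrite divr_gt0 // ltr_wpDl ?normc_ge0.
apply: (@le_trans _ _ (4 * t * (A - u 0))).
  apply: harmonic_near_center hu r0 _ _ _; rewrite ?(ltW t0) //.
  by rewrite subr0 mulrC divfK ?gt_eqF // lerDl.
by apply: le_trans te; nra.
Qed.

(** A weak three circles theorem. Smallness on the inner disc bounds the coefficients up to degree
    n0 by 4 eps / tau^n0; all coefficients of positive degree are at most 4 B. For |w| <= 1/4 one
    factor 2^-m makes the series converge and the other makes the terms beyond n0 small. *)
Lemma harmonic_small_step (B eta rho s : R) : 0 < B -> 0 < eta -> 0 < rho -> rho <= s ->
  exists2 eps : R, 0 < eps & forall u p, is_harmonic u ->
    (forall z, normc (z - p) <= s -> `|u z| <= B) ->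
    (forall z, normc (z - p) <= rho -> `|u z| <= eps) ->
    forall z, normc (z - p) <= 4^-1 * s -> `|u z| <= eta.
Proof.
move=> B0 eta0 rho0 rs; have s0 : 0 < s by exact: lt_le_trans rs.
pose tau := rho / s.
have tau0 : 0 < tau by exact: divr_gt0.
have tau1 : tau <= 1 by rewrite ler_pdivrMr // mul1r.
have B8 : 0 < 16 * B by rewrite mulr_gt0.
have [n0 hn0] := halfX_small (divr_gt0 eta0 B8).
have Bn0 : 8 * B * h n0 <= eta / 2.
  by have := hn0 n0 (leqnn n0); rewrite ltr_pdivlMr //; lra.
have tn0 : 0 < tau ^+ n0 by rewrite exprn_gt0.
pose eps := eta / 2 * tau ^+ n0 / 9.
have eps0 : 0 < eps by rewrite !divr_gt0 ?mulr_gt0 ?divr_gt0.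
have epst : 9 * (eps / tau ^+ n0) = eta / 2 by rewrite /eps; field; rewrite gt_eqF.
have epse : eps <= eps / tau ^+ n0.
  by rewrite ler_pdivlMr // ler_piMr ?(ltW eps0) // exprn_ile1 // ltW.
exists eps => // u p hu uB ueps z hz.
have [a [K ha]] := hu p s s0.
have up : `|u p| <= eps by rewrite ueps // subrr normc0 ltW.
have c1 m : normc (a m.+1) <= 4 * B.
  have -> : 4 * B = 2 * (B + B) by ring.
  apply: le_trans (expansion_coef_le (ltW s0) ha
    (fun z hz => le_trans (ler_norm _) (uB z hz)) (ltn0Sn m)) _.
  rewrite ler_pM2l // lerD2l lerNl; have := uB p; rewrite subrr normc0 (ltW s0) => /(_ isT).
  by rewrite ler_norml => /andP[].
have hrho : harmonic_expansion u p rho (fun m => a m * (tau%:C) ^+ m) K.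
  move=> w M w1; have := ha (tau%:C * w) M.
  rewrite normcM normc_real ger0_norm ?(ltW tau0) //.
  rewrite mulr_ile1 ?normc_ge0 ?(ltW tau0) // => /(_ isT).
  have -> : s%:C * (tau%:C * w) = rho%:C * w.
    by rewrite mulrA -rmorphM /tau mulrC mulrC [s * _]mulrC divfK // gt_eqF.
  by under eq_bigr => m _ do rewrite exprMn mulrA.
have c2 m : normc (a m.+1) * tau ^+ m.+1 <= 4 * eps.
  have -> : 4 * eps = 2 * (eps + eps) by ring.
  have := expansion_coef_le (ltW rho0) hrho
    (fun z hz => le_trans (ler_norm _) (ueps z hz)) (ltn0Sn m).
  rewrite normcM normcX normc_real ger0_norm ?(ltW tau0) // => hle; apply: le_trans hle _.
  by rewrite ler_pM2l // lerD2l lerNl; move: up; rewrite ler_norml => /andP[].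
have [w zE w4] := disc_coord s0 hz; rewrite zE.
have w1 : normc w <= 1 by apply: le_trans w4 _; rewrite invf_le1 ?ler1n.
have E0 : 0 <= eps / tau ^+ n0 by rewrite divr_ge0 // ltW.
have H0 : 0 <= h n0 by rewrite ltW // halfX_gt0.
have D0 : 0 <= 4 * (eps / tau ^+ n0) + 4 * B * h n0.
  by apply: addr_ge0; [exact: mulr_ge0|rewrite mulr_ge0 // mulr_ge0 // ltW].
have key : `|u (p + s%:C * w) - u p| <= 4 * (eps / tau ^+ n0) + 4 * B * h n0.
  apply: (expansion_near ha w1 D0) => m.
  have wm : normc w ^+ m.+1 <= h m.+1 * h m.+1.
    rewrite -exprMn lerXn2r ?nnegrE ?normc_ge0 ?mulr_ge0 ?invr_ge0 //.
    by apply: le_trans w4 _; rewrite -invfM -natrM.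
  have hm0 := ltW (halfX_gt0 R m.+1).
  apply: le_trans (ler_wpM2l (normc_ge0 _) wm) _; rewrite [leLHS]mulrA ler_wpM2r //.
  have [mn|nm] := leqP m.+1 n0.
    apply: (@le_trans _ _ (4 * (eps / tau ^+ n0))); last first.
      by rewrite lerDl mulr_ge0 // mulr_ge0 // ltW.
    rewrite mulrA ler_pdivlMr //; apply: le_trans (c2 m).
    rewrite -mulrA ler_wpM2l ?normc_ge0 //.
    apply: (@le_trans _ _ (1 * tau ^+ n0)).
      by rewrite ler_wpM2r ?(ltW tn0) // halfX_le1.
    by rewrite mul1r ler_wiXn2l // ltW.
  apply: (@le_trans _ _ (4 * B * h n0)); last first.
    by rewrite lerDr mulr_ge0.
  by apply: ler_pM; rewrite ?normc_ge0 // halfX_le // ltnW.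
rewrite -(subrK (u p) (u (p + _))); apply: le_trans (ler_normD _ _) _.
apply: le_trans (lerD key up) _; lra.
Qed.

End Coefficients.

(** * Almost maximal members of a harmonic family *)

Section Chains.
Variable R : realType.
Implicit Types (u v : R[i] -> R).

(** c is the last point before b when the segment from a to b is cut into m + 1 equal parts. *)
Lemma segment_point (a b : R[i]) (m : nat) (d : R) : normc (a - b) <= m.+1%:R * d ->
  exists c, [/\ normc (a - c) <= m%:R * d, normc (c - b) <= d &
    normc a <= 1 -> normc b <= 1 -> normc c <= 1].
Proof.
move=> hd; set M : R := m.+1%:R in hd; have M0 : 0 < M by rewrite ltr0n.
have MM : m%:R = M - 1 by rewrite /M -natr1 addrK.
pose t := M^-1; have t0 : 0 < t by rewrite invr_gt0.
have tM : t * M = 1 by rewrite mulVf ?gt_eqF.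
have t1 : t <= 1 by rewrite invf_le1 // ler1n.
have hdt : normc (a - b) * t <= d by rewrite ler_pdivrMr // mulrC.
exists (b + t%:C * (a - b)); split.
- have -> : a - (b + t%:C * (a - b)) = (1 - t)%:C * (a - b) by rewrite rmorphB rmorph1; ring.
  rewrite normcM normc_real ger0_norm ?subr_ge0 // MM.
  have -> : (M - 1) * d = M * d - t * M * d by rewrite tM; ring.
  have -> : M * d - t * M * d = (1 - t) * (M * d) by ring.
  by rewrite ler_wpM2l // subr_ge0.
- rewrite [b + _]addrC addrK normcM normc_real ger0_norm ?(ltW t0) //.
  by rewrite mulrC.
- move=> a1 b1; have -> : b + t%:C * (a - b) = (1 - t)%:C * b + t%:C * a.
    by rewrite rmorphB rmorph1; ring.
  apply: le_trans (le_normcD _ _) _; rewrite !normcM !normc_real.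
  rewrite !ger0_norm ?subr_ge0 ?(ltW t0) //.
  rewrite -[leRHS](subrK t 1); apply: lerD.
    by rewrite ler_piMr // subr_ge0.
  by rewrite ler_piMr // ltW.
Qed.

Lemma normc_triangle_le (a b : R[i]) (r s t : R) :
  normc (a - b) <= r -> normc b <= s -> r + s <= t -> normc a <= t.
Proof.
move=> h1 h2; apply: le_trans; rewrite -(subrK b a).
by apply: le_trans (le_normcD _ _) _; apply: lerD.
Qed.

Lemma normc_triangle_le3 (a b c : R[i]) (r s t : R) :
  normc (a - b) <= r -> normc (b - c) <= s -> r + s <= t -> normc (a - c) <= t.
Proof.
move=> h1 h2; apply: le_trans; apply: le_trans (le_normc_split b _ _) _.
exact: lerD.
Qed.

(** Around each point of the unit disc there is room 1/16, and a step of 1/32 is half of it: by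
    [harmonic_near_center] with t = 1/2, a step changes v by at most 2 (A + B'). The constant does
    not depend on v. *)
Lemma harnack_chain (A : R) m (B : R) : exists B' : R, forall v a b, is_harmonic v ->
  (forall z, normc z <= 17 / 16 -> v z <= A) ->
  normc a <= 1 -> normc b <= 1 -> normc (a - b) <= m%:R * 32^-1 ->
  - B <= v a -> - B' <= v b.
Proof.
elim: m => [|m [B' IH]] .
  exists B => v a b _ _ _ _; rewrite mul0r => hab.
  have /eqP : normc (a - b) == 0 by rewrite eq_le hab normc_ge0.
  by move=> /eqP; rewrite normc_eq0 subr_eq0 => /eqP ->.
exists (B' + 2 * (A + B')) => v a b hv vA a1 b1 /segment_point [c [ac cb c1]] va.
have vc := IH v a c hv vA a1 (c1 a1 b1) ac va.
have r0 : (0 : R) < 16^-1 by rewrite invr_gt0.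
have t2 : 0 <= (2^-1 : R) <= 2^-1 by rewrite lexx invr_ge0 ler0n.
have vA' w : normc (w - c) <= 16^-1 -> v w <= A.
  move=> hw; apply: vA; apply: normc_triangle_le hw (c1 a1 b1) _; lra.
have hbc : normc (b - c) <= 2^-1 * 16^-1.
  by rewrite normcB; apply: le_trans cb _; lra.
have := harmonic_near_center hv r0 t2 vA' hbc.
rewrite ler_norml => /andP[hb _]; lra.
Qed.

(** The disc of radius 1/128 about one centre contains the disc of radius 1/256 about the next.
    [harmonic_small_step] with s = 1/32 restores the radius s / 4 = 1/128. *)
Lemma smallness_chain (B : R) m (eta : R) : 0 < B -> 0 < eta ->
  exists2 eps : R, 0 < eps & forall u a b, is_harmonic u ->
  (forall z, normc z <= 33 / 32 -> `|u z| <= B) ->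
  normc a <= 1 -> normc b <= 1 -> normc (a - b) <= m%:R * 256^-1 ->
  (forall z, normc (z - a) <= 128^-1 -> `|u z| <= eps) ->
  forall z, normc (z - b) <= 128^-1 -> `|u z| <= eta.
Proof.
move=> B0; elim: m eta => [|m IH] eta eta0.
  exists eta => // u a b _ _ _ _; rewrite mul0r => hab.
  have /eqP : normc (a - b) == 0 by rewrite eq_le hab normc_ge0.
  by move=> /eqP; rewrite normc_eq0 subr_eq0 => /eqP ->.
have rho0 : (0 : R) < 256^-1 by rewrite invr_gt0 ltr0n.
have rs : (256^-1 : R) <= 32^-1 by lra.
have [eps1 eps10 step] := harmonic_small_step B0 eta0 rho0 rs.
have [eps eps0 hIH] := IH _ eps10; exists eps => //.
move=> u a b hu uB a1 b1 /segment_point [c [ac cb c1]] ha z hz.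
apply: (step u b hu) => [w hw|w hw|].
- by apply: uB; apply: normc_triangle_le hw b1 _; lra.
- apply: (hIH u a c hu uB a1 (c1 a1 b1) ac ha).
  by apply: normc_triangle_le3 hw _ _; [rewrite normcB; exact: cb|lra].
- apply: le_trans hz _; lra.
Qed.

Lemma harmonic_small_disc (B eta rho : R) : 0 < B -> 0 < eta -> 0 < rho ->
  exists2 eps : R, 0 < eps & forall u c, is_harmonic u ->
  (forall z, normc z <= 33 / 32 -> `|u z| <= B) -> normc c <= 1 ->
  (forall z, normc (z - c) <= rho -> `|u z| <= eps) ->
  forall z, normc z <= 1 -> `|u z| <= eta.
Proof.
move=> B0 eta0 rho0.
(* 512 steps of 1/256 cover the diameter of the unit disc. *)
have [eps1 eps10 chain] := smallness_chain 512 B0 eta0.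
pose rho' := Num.min rho 32^-1.
have rho'0 : 0 < rho' by rewrite lt_min rho0 invr_gt0 ltr0n.
have rs : rho' <= 32^-1 by rewrite ge_min lexx orbT.
have [eps eps0 step] := harmonic_small_step B0 eps10 rho'0 rs.
exists eps => // u c hu uB c1 ueps z z1.
apply: (chain u c z hu uB c1 z1); last by rewrite subrr normc0 invr_ge0.
  apply: le_trans (le_normcB _ _) _; lra.
move=> w hw; apply: (step u c hu) => [v hv|v hv|].
- by apply: uB; apply: normc_triangle_le hv c1 _; lra.
- by apply: ueps; apply: le_trans hv _; rewrite ge_min lexx.
- apply: le_trans hw _; lra.
Qed.

End Chains.

Section HarmonicFamilies.
Variables (R : realType) (I : finType).
Implicit Types (u : I -> R[i] -> R) (z w : R[i]) (i j k : I).

(** Almost maximality at z with tolerance B. *)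
Definition dominates u k z (B : R) := forall j, u j z - u k z <= B.

Definition dominated_on u c (r B : R) :=
  exists k, forall w, normc (w - c) <= r -> dominates u k w B.

(* The constants are those which rescaling produces in [normalize]. *)
Definition normalized u := (forall j, is_harmonic (u j)) /\
  exists k, forall z, normc z <= 17 / 16 -> dominates u k z 8.

(** Both functions are compared with the dominating member k. The differences u i - u k are at most
    8, and at least -1 where i dominates; a Harnack chain of 64 steps of 1/32 carries the lower
    bound over the unit disc. *)
Lemma normalized_bound : exists2 B : R, 0 < B & forall u, normalized u ->
  forall i j a b, normc a <= 1 -> normc b <= 1 -> dominates u i a 1 -> dominates u j b 1 ->
  forall z, normc z <= 33 / 32 -> `|u i z - u j z| <= B.
Proof.
have [B' hB'] := harnack_chain (8 : R) 64 1.
have [B2 hB2] : exists B2 : R, forall u, normalized u ->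
   forall k, (forall z, normc z <= 17 / 16 -> dominates u k z 8) ->
   forall i a, normc a <= 1 -> dominates u i a 1 ->
   forall z, normc z <= 33 / 32 -> - B2 <= u i z - u k z.
  exists (B' + 2 * (8 + B')) => u [hu _] k hk i a a1 ai z hz.
  have hv : is_harmonic (fun z => u i z - u k z) by exact: harmonicB.
  have vA w : normc w <= 17 / 16 -> u i w - u k w <= 8 by move=> /hk.
  (* A point of the unit disc within 1/32 of z; one more Harnack step reaches z. *)
  pose b := (32 / 33)%:C * z.
  have b1 : normc b <= 1.
    rewrite normcM normc_real ger0_norm ?divr_ge0 //.
    by have := normc_ge0 z; lra.
  have bz : normc (z - b) <= 2^-1 * 16^-1.
    have -> : z - b = (33^-1 : R)%:C * z.
      have -> : (33^-1 : R) = 1 - 32 / 33 by field.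
      by rewrite rmorphB rmorph1 mulrBl mul1r.
    rewrite normcM normc_real ger0_norm ?invr_ge0 //.
    by have := normc_ge0 z; lra.
  have ab : normc (a - b) <= 64%:R * 32^-1.
    apply: le_trans (le_normcB _ _) _; lra.
  have va : - 1 <= u i a - u k a by have := ai k; lra.
  have vb := hB' _ a b hv vA a1 b1 ab va.
  have r0 : (0 : R) < 16^-1 by rewrite invr_gt0.
  have t2 : 0 <= (2^-1 : R) <= 2^-1 by rewrite lexx invr_ge0 ler0n.
  have vA' w : normc (w - b) <= 16^-1 -> u i w - u k w <= 8.
    by move=> hw; apply: vA; apply: normc_triangle_le hw b1 _; lra.
  have := harmonic_near_center hv r0 t2 vA' bz.
  rewrite ler_norml => /andP[hb _]; lra.
exists (`|B2| + 8) => [|u nu i j a b a1 b1 ai bj z hz]; first by rewrite ltr_wpDl.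
have [_ [k hk]] := nu.
have hz' : normc z <= 17 / 16 by apply: le_trans hz _; lra.
have := hB2 u nu k hk i a a1 ai z hz; have := hB2 u nu k hk j b b1 bj z hz.
have := hk z hz' i; have := hk z hz' j; have := ler_norm B2.
rewrite ler_norml => *; apply/andP; split; lra.
Qed.

(** The threshold 1/4 plus the tolerance 1/2 of [normalized_majority] stays below 1. *)
Definition close u i j := forall z, normc z <= 1 -> `|u i z - u j z| <= 4^-1.

(* It matters that rho and e do not depend on u. Each pair costs a shrinking of
   the ball: a pair which is not close is separated somewhere by
   [harmonic_small_disc], hence on a small ball by [harmonic_near_center]. *)
Lemma separating_ball (l : seq (I * I)) : exists rho e : R, [/\ 0 < rho, 0 < e, e <= 1 &
  forall u, normalized u -> exists2 c, normc c + rho <= 1 &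
    forall p, p \in l -> close u p.1 p.2 \/
      forall z, normc (z - c) <= rho -> ~ (dominates u p.1 z e /\ dominates u p.2 z e)].
Proof.
have [B B0 hB] := normalized_bound.
elim: l => [|[i j] l [rho [e [rho0 e0 e1 IH]]]].
  exists 1, 1; split => // u _; exists 0 => [|p]; first by rewrite normc0 add0r.
  by rewrite in_nil.
have eta0 : (0 : R) < 4^-1 by rewrite invr_gt0.
have rho20 : 0 < rho / 2 by exact: divr_gt0.
have [eps eps0 small] := harmonic_small_disc B0 eta0 rho20.
pose e' := Num.min e (eps / 2).
have e'0 : 0 < e' by rewrite lt_min e0 divr_gt0.
have e'e : e' <= e by rewrite ge_min lexx.
have e'eps : e' <= eps / 2 by rewrite ge_min lexx orbT.
have B8 : 0 < 16 * B by exact: mulr_gt0.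
(* On a ball of radius t / 32 the difference varies by at most 8 t B <= e' / 2. If both members
   dominated within e' there, it would be at most 3 e' / 2 < eps at the centre, where it exceeds
   eps. *)
pose t := Num.min 2^-1 (e' / (16 * B)).
have t0 : 0 < t by rewrite lt_min invr_gt0 ltr0n divr_gt0.
have t2 : t <= 2^-1 by rewrite ge_min lexx.
have te : t * (16 * B) <= e' by rewrite -ler_pdivlMr // ge_min lexx orbT.
pose rho' := Num.min (rho / 2) (t * 32^-1).
have rho'0 : 0 < rho' by rewrite lt_min rho20 mulr_gt0 ?invr_gt0.
have rho'1 : rho' <= rho / 2 by rewrite ge_min lexx.
have rho'2 : rho' <= t * 32^-1 by rewrite ge_min lexx orbT.
have domW u k z : dominates u k z e' -> dominates u k z e.
  by move=> h j'; apply: le_trans e'e.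
have dom1 u k z : dominates u k z e' -> dominates u k z 1.
  by move=> /domW h j'; apply: le_trans e1.
exists rho', e'; split => //; first exact: le_trans e1.
move=> u nu; have [c c1 hc] := IH u nu.
have shrink c' : normc (c' - c) <= rho / 2 ->
    forall z, normc (z - c') <= rho' -> normc (z - c) <= rho.
  move=> h1 z hz; apply: normc_triangle_le3 hz h1 _; lra.
have old c' : normc (c' - c) <= rho / 2 -> forall p, p \in l -> close u p.1 p.2 \/
     forall z, normc (z - c') <= rho' -> ~ (dominates u p.1 z e' /\ dominates u p.2 z e').
  move=> h1 p /hc [|far]; [by left|right => z hz [d1 d2]].
  by apply: (far z (shrink _ h1 _ hz)); split; exact: domW.
have cc : normc (c - c) <= rho / 2 by rewrite subrr normc0 ltW.
have [cl|ncl] := pselect (close u i j).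
  exists c; first lra.
  by move=> p; rewrite in_cons => /predU1P [->|/(old c cc)]; [left|].
(* A point where both members dominate gives access to the two-sided bound of [normalized_bound]; if
   there is none near c, the centre c already separates them. *)
have [both|nboth] := pselect (exists2 z, normc (z - c) <= rho' &
  dominates u i z e' /\ dominates u j z e'); last first.
  exists c; first lra.
  move=> p; rewrite in_cons => /predU1P [->|/(old c cc) //]; right => z hz dd.
  by apply: nboth; exists z.
have in1 z : normc (z - c) <= rho -> normc z <= 1.
  by move=> hz; apply: normc_triangle_le hz (lexx _) _; lra.
have [z0 hz0 [di dj]] := both.
have z01 : normc z0 <= 1 by apply: in1; apply: le_trans hz0 _; lra.
have dB := hB u nu i j z0 z0 z01 z01 (dom1 _ _ _ di) (dom1 _ _ _ dj).
have hd : is_harmonic (fun z => u i z - u j z) by apply: harmonicB; apply: nu.1.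
have c1' : normc c <= 1 by lra.
have [c' hc' far] : exists2 c', normc (c' - c) <= rho / 2 & eps < `|u i c' - u j c'|.
  apply: contrapT => nex; apply: ncl => z z1.
  apply: (small _ c hd dB c1') => // w hw; rewrite leNgt; apply/negP => hlt.
  by apply: nex; exists w.
exists c'.
  suff : normc c' <= normc c + rho / 2 by lra.
  by apply: normc_triangle_le hc' (lexx _) _; lra.
move=> p; rewrite in_cons => /predU1P [->|/(old c' hc') //]; right => z hz [/= d1 d2].
have c'1 : normc c' <= 1 by apply: in1; apply: le_trans hc' _; lra.
have r0 : (0 : R) < 32^-1 by rewrite invr_gt0.
have t02 : 0 <= t <= 2^-1 by rewrite (ltW t0).
have dB' w : normc (w - c') <= 32^-1 -> u i w - u j w <= B.
  move=> hw; apply: le_trans (ler_norm _) _; apply: dB.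
  by apply: normc_triangle_le hw c'1 _; lra.
have := harmonic_near_center hd r0 t02 dB' (le_trans hz rho'2).
have dc : `|u i c' - u j c'| <= B.
  by apply: dB; apply: le_trans c'1 _; lra.
have hBd : B - (u i c' - u j c') <= 2 * B by move: dc; rewrite ler_norml => /andP[]; lra.
have h4 : 4 * t * (B - (u i c' - u j c')) <= e' / 2.
  apply: le_trans (ler_wpM2l _ hBd) _; first by rewrite mulr_ge0 // ltW.
  lra.
move=> hn; have {}hn := le_trans hn h4.
have h5 := d1 j; have h6 := d2 i.
have h7 : `|u i z - u j z| <= e' by rewrite ler_norml; apply/andP; split; lra.
have : `|u i c' - u j c'| <= e' / 2 + e'.
  rewrite -[u i c' - u j c'](subKr (u i z - u j z)).
  by apply: le_trans (ler_normB _ _) _; rewrite addrC; apply: lerD.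
move=> hh; move: far; rewrite ltNge => /negP; apply; apply: le_trans hh _; lra.
Qed.

End HarmonicFamilies.

(** * Rescaling *)

Section Majority.
Variables (R : realType) (I : finType).
Implicit Types (u : I -> R[i] -> R) (z w : R[i]) (i j k : I).

Definition majority_dominates u (e : R) := forall z,
  exists2 A : {set I}, (#|I| < #|A| + #|A|)%N & forall k, k \in A -> dominates u k z e.

Lemma majority_meet (A B : {set I}) : (#|I| < #|A| + #|A|)%N -> (#|I| < #|B| + #|B|)%N ->
  exists2 k, k \in A & k \in B.
Proof.
move=> hA hB; have [k /=|AB0] := pickP (mem (A :&: B)).
  by rewrite finset.in_setI => /andP[kA kB]; exists k.
have := cardsUI A B; rewrite (eq_card0 AB0) addn0 => e.
have : (#|A :|: B| <= #|I|)%N by exact: max_card.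
rewrite e; lia.
Qed.

(* At a point where almost maximal members are pairwise close on the unit disc,
   any one of them dominates the whole disc. *)
Lemma normalized_majority : exists2 e : R, 0 < e & forall u, normalized u ->
  majority_dominates u e -> dominated_on u 0 1 1.
Proof.
have [rho [e [rho0 e0 e1 sep]]] := separating_ball R (enum {: I * I}).
have e20 : 0 < Num.min e 2^-1 by rewrite lt_min e0 invr_gt0 ltr0n.
exists (Num.min e 2^-1) => // u nu maj.
have [c c1 hc] := sep u nu; have [A hA Adom] := maj c.
(* A majority meets itself, hence is nonempty. *)
have [b bA _] := majority_meet hA hA.
exists b => w; rewrite subr0 => w1 j.
have [B hB Bdom] := maj w; have [k kA kB] := majority_meet hA hB.
have domW i z : dominates u i z (Num.min e 2^-1) -> dominates u i z e.
  by move=> h j'; apply: le_trans (h j') _; rewrite ge_min lexx.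
(* Both k and b dominate at c, which rules out separation there. *)
have [cl|far] := hc (k, b) (mem_enum _ _).
  have := cl w w1; rewrite ler_norml => /andP[_ /= h1].
  have : u j w - u k w <= 2^-1 by apply: le_trans (Bdom k kB j) _; rewrite ge_min lexx orbT.
  lra.
have cc : normc (c - c) <= rho by rewrite subrr normc0 ltW.
by case: (far c cc); split; apply: domW; exact: Adom.
Qed.

Lemma dominated_on_sub u c c' (r r' B : R) : dominated_on u c r B ->
  (forall w, normc (w - c') <= r' -> normc (w - c) <= r) -> dominated_on u c' r' B.
Proof. by move=> [k hk] hw; exists k => w /hw; exact: hk. Qed.

(* Compare the member dominating the unit disc with the member dominating a disc
   around a nearby point. *)
Lemma normalize u : (forall j, is_harmonic (u j)) ->
  (forall z, normc z <= 1 -> dominated_on u z 2^-1 2) -> dominated_on u 0 1 2 ->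
  normalized u.
Proof.
move=> hu hloc [k0 hk0]; split => //; exists k0 => z hz j.
have {}hk0 w : normc w <= 1 -> dominates u k0 w 2 by move=> ?; apply: hk0; rewrite subr0.
have [z1|z1] := leP (normc z) 1; first by have := hk0 z z1 j; lra.
have nz0 : 0 < normc z by apply: lt_trans z1.
(* p lies on the ray of z at modulus 15/16, so |z - p| <= 1/8, a quarter of the radius 1/2 of the
   local disc. *)
pose t := 15 / 16 / normc z.
have tz : t * normc z = 15 / 16 by rewrite divfK // gt_eqF.
have t0 : 0 < t by rewrite !divr_gt0.
have t1 : t <= 1 by rewrite ler_pdivrMr //; lra.
pose p := t%:C * z.
have pn : normc p = 15 / 16 by rewrite normcM normc_real ger0_norm ?(ltW t0).
have p1 : normc p <= 1 by rewrite pn; lra.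
have zp : normc (z - p) <= 4^-1 * 2^-1.
  have -> : z - p = (1 - t)%:C * z by rewrite /p rmorphB rmorph1; ring.
  by rewrite normcM normc_real ger0_norm ?subr_ge0 // mulrBl tz; lra.
have [k hk] := hloc p p1.
have hv : is_harmonic (fun w => u k0 w - u k w) by exact: harmonicB.
have v2 w : normc (w - p) <= 2^-1 -> u k0 w - u k w <= 2 by move=> /hk.
have r0 : (0 : R) < 2^-1 by rewrite invr_gt0.
have t4 : 0 <= (4^-1 : R) <= 2^-1 by apply/andP; split; lra.
(* Origin of the 8 in [normalized]: u k0 - u k is at least -2 at p, hence at least -6 at z, where k
   dominates within 2. *)
have := harmonic_near_center hv r0 t4 v2 zp.
have := hk0 p p1 k; have zp2 : normc (z - p) <= 2^-1 by apply: le_trans zp _; lra.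
have := hk z zp2 j; rewrite ler_norml => h1 h2 /andP[h3 _]; lra.
Qed.

Lemma harmonic_bounded_disc u (r : R) : 0 < r -> (forall j, is_harmonic (u j)) ->
  exists B : R, forall j w, normc w <= r -> `|u j w| <= B.
Proof.
move=> r0 hu.
have /choice [B hB] : forall j, exists B : R, forall w, normc w <= r -> `|u j w| <= B.
  move=> j; have [a [K ha]] := hu j 0 r r0; exists K => w hw.
  have hw' : normc (w - 0) <= 1 * r by rewrite subr0 mul1r.
  have [v -> v1] := disc_coord r0 hw'.
  by have := ha v 0%N v1; rewrite big_ord0 subr0 expr0 mulr1.
exists (\sum_j `|B j|) => j w hw; apply: le_trans (hB j w hw) _.
apply: le_trans (ler_norm _) _; rewrite (bigD1 j) //= lerDl.
by apply: sumr_ge0.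
Qed.

(** Testing domination only at the levels 2^n M0 gives a disc that is extremal up to a factor 2,
    without a supremum. *)
Lemma majority_dominated u (C : R) : 0 <= C -> (forall j, is_harmonic (u j)) ->
  majority_dominates u C -> exists k B, forall z, dominates u k z B.
Proof.
move=> C0 hu maj; apply: contrapT => nex.
have [e e0 he] := normalized_majority.
(* After division by any M >= M0 the tolerance C becomes at most e. *)
pose M0 := C / e + 1.
have M00 : 0 < M0 by rewrite ltr_wpDl // divr_ge0 // ltW.
have CM0 : C <= e * M0 by rewrite /M0 mulrDr mulr1 mulrC divfK ?gt_eqF // lerDl ltW.
have /choice [y hy] : forall k, exists z, ~ dominates u k z M0.
  by move=> k; apply/existsNP => h; apply: nex; exists k, M0.
(* The disc of radius r / 2 about 0 contains, for each k, a point where k does not dominate within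
   [M0]; so level 0 fails at the centre 0. *)
pose r := 2 * (\sum_k normc (y k)) + 1.
have S0 : 0 <= \sum_k normc (y k) by apply: sumr_ge0 => k _; exact: normc_ge0.
have r0 : 0 < r by rewrite ltr_wpDl // mulr_ge0.
have yr k : normc (y k) <= r / 2.
  apply: (@le_trans _ _ (\sum_k normc (y k))); last by rewrite /r; lra.
  by rewrite (bigD1 k) //= lerDl sumr_ge0 // => j _; exact: normc_ge0.
(* The radius is half the distance to the circle of radius r: all discs stay inside, and discs with
   nearby centres have comparable radii. *)
pose Q (n : nat) := forall z, normc z < r -> dominated_on u z ((r - normc z) / 2) (2 ^+ n * M0).
have [B hB] := harmonic_bounded_disc r0 hu.
have [i0 Qi0] : exists n, Q n.
  have e20 : 0 < M0 / (2 * `|B| + 1) by rewrite divr_gt0 // ltr_wpDl // mulr_ge0.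
  have [N hN] := halfX_small e20; exists N => z zr.
  have [A hA _] := maj 0; have [k _ _] := majority_meet hA hA.
  exists k => w hw j.
  have wr : normc w <= r by apply: normc_triangle_le hw (lexx _) _; lra.
  have BN : 2 * `|B| <= 2 ^+ N * M0.
    have B1 : 0 < 2 * `|B| + 1 by rewrite ltr_wpDl // mulr_ge0.
    have := hN N (leqnn N); rewrite ltr_pdivlMr // exprVn.
    rewrite mulrC ltr_pdivrMr ?exprn_gt0 // [M0 * _]mulrC => /ltW; apply: le_trans.
    by rewrite lerDl.
  apply: le_trans BN.
  have := hB j w wr; have := hB k w wr; have := ler_norm B.
  by rewrite !ler_norml => h1 /andP[h2 h3] /andP[h4 h5]; lra.
have nQ0 : ~ Q 0%N.
  move=> /(_ 0); rewrite normc0 subr0 expr0 mul1r => /(_ r0) [k hk].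
  by apply: (hy k); apply: hk; rewrite subr0.
(* Level n fails on some disc and level n+1 holds on all of them: rescale at the
   former. *)
have [n [nQi QSi]] : exists n, ~ Q n /\ Q n.+1.
  apply: contrapT => hn; suff : forall n, ~ Q n by move=> /(_ i0).
  by elim=> // n IH QSn; apply: hn; exists n.
have /existsNP [z0 /not_implyP [z0r nz0]] := nQi.
set M := 2 ^+ n * M0 in nz0.
have M1 : 0 < M by rewrite mulr_gt0 ?exprn_gt0.
have M0M : M0 <= M by rewrite ler_peMl ?(ltW M00) // exprn_ege1 // ler1n.
set s := (r - normc z0) / 2 in nz0.
have s0 : 0 < s by rewrite divr_gt0 // subr_gt0.
pose v j w := M^-1 * u j (z0 + s%:C * w).
have vdom w k (D : R) : dominates u k (z0 + s%:C * w) (D * M) -> dominates v k w D.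
  by move=> dom j; rewrite /v -mulrBr ler_pdivrMl // [M * D]mulrC; exact: dom.
have domv w k (D : R) : dominates v k w D -> dominates u k (z0 + s%:C * w) (D * M).
  by move=> dom j; have := dom j; rewrite /v -mulrBr ler_pdivrMl // [M * D]mulrC.
have vdon c (t D : R) : dominated_on u (z0 + s%:C * c) (t * s) (D * M) -> dominated_on v c t D.
  move=> [k hk]; exists k => w hw; apply: vdom; apply: hk.
  have -> : z0 + s%:C * w - (z0 + s%:C * c) = s%:C * (w - c) by ring.
  by rewrite normcM normc_real ger0_norm ?(ltW s0) // mulrC ler_pM2r.
have hv j : is_harmonic (v j) by exact: harmonicZ_affine.
have Q2 z : normc z < r -> dominated_on u z ((r - normc z) / 2) (2 * M).
  by move=> /QSi; rewrite exprS mulrA.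
(* The point z0 + s z is at distance at least s from the circle of radius r, so its disc has radius
   at least s / 2. *)
have loc z : normc z <= 1 -> dominated_on v z 2^-1 2.
  move=> z1; apply: vdon.
  have zs : normc (z0 + s%:C * z) <= normc z0 + s.
    apply: le_trans (le_normcD _ _) _; rewrite lerD2l normcM normc_real.
    by rewrite ger0_norm ?(ltW s0) // ler_piMr // ltW.
  have zr : normc (z0 + s%:C * z) < r by apply: le_lt_trans zs _; rewrite /s; lra.
  apply: dominated_on_sub (Q2 _ zr) _ => w hw; apply: le_trans hw _.
  by rewrite /s in zs *; lra.
have loc0 : dominated_on v 0 1 2.
  by apply: vdon; rewrite mulr0 addr0 mul1r; exact: Q2.
have maj' : majority_dominates v e.
  move=> z; have [A hA Adom] := maj (z0 + s%:C * z); exists A => // k kA.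
  apply: vdom => j; apply: le_trans (Adom k kA j) _; apply: le_trans CM0 _.
  by rewrite ler_pM2l.
(* Tolerance 1 after rescaling is level n on the disc where that level fails. *)
have [k hk] := he v (normalize hv loc loc0) maj'.
apply: nz0; exists k => w hw.
have hw' : normc (w - z0) <= 1 * s by rewrite mul1r.
have [w' -> w'1] := disc_coord s0 hw'.
rewrite -[M]mul1r; apply: domv; apply: hk; by rewrite subr0.
Qed.

End Majority.

(** * Compactness *)

Section Compactness.
Variable R : realType.

(** Filters are used for the sake of an ultrafilter, along which all bounded sequences converge at
    once, with no extraction of subsequences. *)
Definition limit_along (F : set_system nat) (x : nat -> R[i]) (l : R[i]) :=
  forall e : R, 0 < e -> \forall k \near F, normc (x k - l) <= e.

Lemma limit_alongP (F : set_system nat) (FF : Filter F) (x : nat -> R[i]^o) (l : R[i]^o) :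
  limit_along F x l <-> x k @[k --> F] --> l.
Proof.
split=> [hx|/cvgrPdist_le hx e e0]; last first.
  have := hx e%:C; rewrite ltcR => /(_ e0); apply: filterS => k.
  by rewrite distrC -normc_normr lecR.
apply/cvgrPdist_le => e e0; have er : e \is Num.real by exact: gtr0_real.
have := hx (Re e); rewrite -ltcR RRe_real // => /(_ e0); apply: filterS => k.
by rewrite -lecR RRe_real // normc_normr distrC.
Qed.

Lemma limit_along_cst (F : set_system nat) (FF : Filter F) (l : R[i]) :
  limit_along F (fun=> l) l.
Proof. by move=> e e0; apply: nearW => k; rewrite subrr normc0 ltW. Qed.

Lemma limit_alongD (F : set_system nat) (FF : Filter F) (x y : nat -> R[i]) (l m : R[i]) :
  limit_along F x l -> limit_along F y m -> limit_along F (fun k => x k + y k) (l + m).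
Proof.
move=> /limit_alongP hx /limit_alongP hy.
by apply/(@limit_alongP _ _ (fun k => x k + y k)); exact: cvgD hx hy.
Qed.

Lemma limit_alongM (F : set_system nat) (FF : Filter F) (x y : nat -> R[i]) (l m : R[i]) :
  limit_along F x l -> limit_along F y m -> limit_along F (fun k => x k * y k) (l * m).
Proof.
move=> /limit_alongP hx /limit_alongP hy.
by apply/(@limit_alongP _ _ (fun k => x k * y k)); exact: cvgM hx hy.
Qed.

Lemma ultra_bounded_real (U : set_system nat) (UU : UltraFilter U) (x : nat -> R) :
  (forall k, `|x k| <= 1) -> exists l : R, forall e : R, 0 < e ->
    \forall k \near U, `|x k - l| <= e.
Proof.
move=> hx; have PF : ProperFilter (x k @[k --> U]) by exact: fmap_proper_filter.
have Ux : (x k @[k --> U]) `[-1, 1]%classic.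
  by apply: nearW => k; rewrite /= in_itv /= -ler_norml.
have [l [_ hl]] := @segment_compact R (-1) 1 _ PF Ux.
exists l => e e0; have [//|hn] := in_ultra_setVsetC [set k | `|x k - l| <= e] UU.
have hA : (x k @[k --> U]) [set y | ~ (`|y - l| <= e)] by exact: hn.
have hB : nbhs l [set y | `|y - l| <= e].
  apply/nbhs_ballP; exists e => //= y; rewrite -ball_normE /= distrC; exact: ltW.
by have [y [/= h1 h2]] := hl _ _ hA hB.
Qed.

Lemma ultra_bounded (U : set_system nat) (UU : UltraFilter U) (x : nat -> R[i]) :
  (forall k, normc (x k) <= 1) -> exists l, limit_along U x l.
Proof.
move=> hx.
have [l1 h1] := ultra_bounded_real UU (fun k => le_trans (normc_Re (x k)) (hx k)).
have [l2 h2] := ultra_bounded_real UU (fun k => le_trans (normc_Im (x k)) (hx k)).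
exists (l1 +i* l2) => e e0.
have e2 : 0 < e / 2 by exact: divr_gt0.
apply: filterS2 (h1 _ e2) (h2 _ e2) => k a1 a2.
apply: le_trans (normc_le_ReIm _) _; rewrite [e]splitr.
by case: (x k) a1 a2 => a b /= a1 a2; exact: lerD.
Qed.

Lemma limit_along_sum (F : set_system nat) (FF : Filter F) (T : Type) (s : seq T)
    (x : nat -> T -> R[i]) (l : T -> R[i]) :
  (forall t, limit_along F (x^~ t) (l t)) ->
  limit_along F (fun k => \sum_(t <- s) x k t) (\sum_(t <- s) l t).
Proof.
move=> hx; elim: s => [|t s IH].
  rewrite big_nil (_ : (fun k => _) = fun=> 0); first exact: limit_along_cst.
  by apply/funext => k; rewrite big_nil.
rewrite big_cons (_ : (fun k => _) = fun k => x k t + \sum_(t <- s) x k t).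
  exact: limit_alongD.
by apply/funext => k; rewrite big_cons.
Qed.

Lemma limit_along_prod (F : set_system nat) (FF : Filter F) (T : Type) (s : seq T)
    (x : nat -> T -> R[i]) (l : T -> R[i]) :
  (forall t, limit_along F (x^~ t) (l t)) ->
  limit_along F (fun k => \prod_(t <- s) x k t) (\prod_(t <- s) l t).
Proof.
move=> hx; elim: s => [|t s IH].
  rewrite big_nil (_ : (fun k => _) = fun=> 1); first exact: limit_along_cst.
  by apply/funext => k; rewrite big_nil.
rewrite big_cons (_ : (fun k => _) = fun k => x k t * \prod_(t <- s) x k t).
  exact: limit_alongM.
by apply/funext => k; rewrite big_cons.
Qed.

Lemma limit_along_expr (F : set_system nat) (FF : Filter F) (x : nat -> R[i]) (l : R[i]) n :
  limit_along F x l -> limit_along F (fun k => x k ^+ n) (l ^+ n).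
Proof.
move=> hx; elim: n => [|n IH]; first exact: limit_along_cst.
rewrite exprS (_ : (fun k => _) = fun k => x k * x k ^+ n); first exact: limit_alongM.
by apply/funext => k; rewrite exprS.
Qed.

Lemma limit_along_meval (F : set_system nat) (FF : Filter F) n (p : mpoly n R[i])
    (w : nat -> 'I_n -> R[i]) (v : 'I_n -> R[i]) :
  (forall i, limit_along F (w^~ i) (v i)) ->
  limit_along F (fun k => meval (w k) p) (meval v p).
Proof.
move=> hw; rewrite mevalE.
rewrite (_ : (fun k => _) = fun k => \sum_(m <- msupp p) mcoeff m p * \prod_i w k i ^+ m i).
  apply: limit_along_sum => m; apply: limit_alongM; first exact: limit_along_cst.
  by apply: limit_along_prod => i; exact: limit_along_expr.
by apply/funext => k; rewrite mevalE.
Qed.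

Definition norm1 n (v : 'rV[R[i]]_n) : R := \sum_i normc (v 0 i).

Definition linear_form n (a v : 'rV[R[i]]_n) : R[i] := \sum_i a 0 i * v 0 i.

Lemma normc_le_norm1 n (v : 'rV[R[i]]_n) i : normc (v 0 i) <= norm1 v.
Proof. by rewrite /norm1 (bigD1 i) //= lerDl sumr_ge0 // => j _; exact: normc_ge0. Qed.

Lemma norm1_ge0 n (v : 'rV[R[i]]_n) : 0 <= norm1 v.
Proof. by apply: sumr_ge0 => i _; exact: normc_ge0. Qed.

Lemma norm1_eq0 n (v : 'rV[R[i]]_n) : norm1 v = 0 -> v = 0.
Proof.
move=> v0; apply/rowP => i; rewrite mxE; apply/eqP; rewrite -normc_eq0.
by rewrite eq_le normc_ge0 andbT -v0 normc_le_norm1.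
Qed.

Lemma norm1Z n (c : R[i]) (v : 'rV[R[i]]_n) : norm1 (c *: v) = normc c * norm1 v.
Proof. by rewrite /norm1 mulr_sumr; apply: eq_bigr => i _; rewrite mxE normcM. Qed.

Lemma linear_formZ n (c : R[i]) (a v : 'rV[R[i]]_n) :
  linear_form a (c *: v) = c * linear_form a v.
Proof. by rewrite /linear_form mulr_sumr; apply: eq_bigr => i _; rewrite mxE mulrCA. Qed.

Lemma linear_form_le n (a v : 'rV[R[i]]_n) : normc (linear_form a v) <= norm1 a * norm1 v.
Proof.
apply: le_trans (normc_sum _ _ _) _; rewrite /norm1 mulr_suml; apply: ler_sum => i _.
by rewrite normcM ler_wpM2l ?normc_ge0 // normc_le_norm1.
Qed.

(** Otherwise there are vectors of norm 1 in the cone on which all the forms tend to 0. Their limit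
    lies in the cone and is killed by the forms, so it is 0, against the norm 1. *)
Lemma cone_lower_bound n (J : finType) (L : J -> 'rV[R[i]]_n) (S : set (mpoly n R[i])) :
  (forall p (v : 'rV[R[i]]_n) (c : R[i]), S p -> meval (fun i => v 0 i) p = 0 ->
     meval (fun i => (c *: v) 0 i) p = 0) ->
  (forall v : 'rV[R[i]]_n, (forall p, S p -> meval (fun i => v 0 i) p = 0) ->
     (forall j, linear_form (L j) v = 0) -> v = 0) ->
  exists2 c : R, 0 < c & forall v : 'rV[R[i]]_n,
    (forall p, S p -> meval (fun i => v 0 i) p = 0) -> v != 0 ->
    exists j, c * norm1 v <= normc (linear_form (L j) v).
Proof.
move=> hS hL; apply: contrapT => nex.
have /choice [w hw] : forall k : nat, exists w : 'rV[R[i]]_n,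
    [/\ forall p, S p -> meval (fun i => w 0 i) p = 0, norm1 w = 1 &
      forall j, normc (linear_form (L j) w) <= k.+1%:R^-1].
  move=> k; apply: contrapT => nw; apply: nex; exists k.+1%:R^-1; first by rewrite invr_gt0.
  move=> v vS v0; apply: contrapT => nj; apply: nw.
  have nv : 0 < norm1 v.
    by rewrite lt_def norm1_ge0 andbT; apply: contraNneq v0 => /norm1_eq0 ->.
  have nvi : normc (norm1 v)%:C^-1 = (norm1 v)^-1.
    by rewrite normcV normc_real ger0_norm ?norm1_ge0.
  exists ((norm1 v)%:C^-1 *: v); split.
  - by move=> p Sp; apply: hS => //; exact: vS.
  - by rewrite norm1Z nvi mulVf // gt_eqF.
  - move=> j; rewrite linear_formZ normcM nvi ler_pdivrMl // mulrC leNgt; apply/negP => hlt.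
    by apply: nj; exists j; exact: ltW.
(* [U] refines the filter of eventual properties, so bounds valid for large k hold along it. *)
have [U [UU sU]] := ultraFilterLemma (eventually_filter : ProperFilter \oo).
have /choice [l hl] : forall i, exists l, limit_along U (fun k => w k 0 i) l.
  move=> i; apply: ultra_bounded => k; have [_ <- _] := hw k; exact: normc_le_norm1.
pose v : 'rV[R[i]]_n := \row_i l i.
have vE i : v 0 i = l i by rewrite mxE.
have uniq0 (z : R[i]) : (forall e : R, 0 < e -> normc z <= e) -> z = 0.
  move=> hz; apply/eqP; rewrite -normc_eq0 eq_le normc_ge0 andbT.
  by apply/ler_addgt0Pr => e e0; rewrite add0r hz.
have vS p : S p -> meval (fun i => v 0 i) p = 0.
  move=> Sp; apply: uniq0 => e e0.
  have hh i : limit_along U (fun k => w k 0 i) (v 0 i) by rewrite vE.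
  have [k] := filter_ex (limit_along_meval _ p hh e0).
  by have [-> // _ _] := hw k; rewrite sub0r normcN.
have vL j : linear_form (L j) v = 0.
  apply: uniq0 => e e0; have e2 : 0 < e / 2 by exact: divr_gt0.
  have cL : limit_along U (fun k => linear_form (L j) (w k)) (linear_form (L j) v).
    apply: limit_along_sum => i.
    by apply: limit_alongM; [exact: limit_along_cst|rewrite vE].
  have small : \forall k \near U, normc (linear_form (L j) (w k)) <= e / 2.
    apply: sU; apply: filterS (near_infty_natSinv_lt (PosNum e2)) => k /= hk.
    by have [_ _ hj] := hw k; apply: le_trans (hj j) (ltW hk).
  have [k [h1 h2]] := filter_ex (filterI (cL _ e2) small).
  rewrite [e]splitr -[X in normc X](subKr (linear_form (L j) (w k))).
  by apply: le_trans (le_normcB _ _) _; rewrite addrC; apply: lerD.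
have v0 := hL v vS vL.
(* n coordinates of this size have sum at most 1/2 < 1; [n.+1] avoids division by zero. *)
have e0 : 0 < (2 * n.+1%:R)^-1 :> R by rewrite invr_gt0 mulr_gt0.
have near0 i : \forall k \near U, normc (w k 0 i) <= (2 * n.+1%:R)^-1.
  have := hl i _ e0; apply: filterS => k.
  by rewrite -vE v0 mxE subr0.
have [k hk] : exists k, forall i, normc (w k 0 i) <= (2 * n.+1%:R)^-1.
  by apply: (@filter_ex _ U); exact: filter_forall.
have [_ w1 _] := hw k.
suff : norm1 (w k) <= 2^-1 by rewrite w1; lra.
apply: (@le_trans _ _ (\sum_(i < n) (2 * n.+1%:R)^-1)); first exact: ler_sum.
rewrite sumr_const card_ord -[_ *+ n]mulr_natl invfM mulrCA ler_piMr ?invr_ge0 //.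
by rewrite ler_pdivrMr ?ltr0n // mul1r ler_nat.
Qed.

End Compactness.

(** * Curves in projective space *)

Section ProjectiveCurves.
Variables (R : realType) (m : nat).
Implicit Types (x : projective_space R[i] m) (a v : 'rV[R[i]]_m.+1).

Lemma homogeneous_coords_neq0 x : homogeneous_coords x != 0.
Proof.
rewrite /homogeneous_coords vpick0 -dimv_eq0; case: x => L /= /eqP ->.
exact: oner_neq0.
Qed.

Lemma projective_lineE x v : v \in val x -> v != 0 -> val x = <[v]>%VS.
Proof.
case: x => L /= /eqP dL vL v0; apply/eqP; rewrite eq_sym eqEdim -memvE vL.
by rewrite dL dim_vline v0.
Qed.

Lemma homogeneous_coords_mem x : homogeneous_coords x \in val x.
Proof. exact: memv_pick. Qed.

Lemma homogeneous_meval d (p : mpoly m.+1 R[i]) v (c : R[i]) :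
  p \is @ishomog1 m.+1 R[i] d mdeg ->
  meval (fun i => (c *: v) 0 i) p = c ^+ d * meval (fun i => v 0 i) p.
Proof.
move=> hp; rewrite !mevalE mulr_sumr big_seq [RHS]big_seq; apply: eq_bigr => k kp.
rewrite mulrCA; congr (_ * _).
rewrite (eq_bigr (fun i => c ^+ k i * v 0 i ^+ k i)); last first.
  by move=> i _; rewrite mxE exprMn.
rewrite big_split /=; congr (_ * _).
have dk : mdeg k = d by exact: dhomog_mf hp _ kp.
rewrite -dk mdegE.
by elim/big_ind2: _ => // a1 a2 b1 b2 -> ->; rewrite exprD.
Qed.

Lemma vanishes_atE (p : mpoly m.+1 R[i]) d x v : p \is @ishomog1 m.+1 R[i] d mdeg ->
  v \in val x -> v != 0 -> meval (fun i => v 0 i) p = 0 -> vanishes_at p x.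
Proof.
move=> hp vx v0 pv w; rewrite (projective_lineE vx v0) => /vlineP [c ->].
by rewrite (homogeneous_meval v c hp) pv mulr0.
Qed.

Lemma linear_form_hyperplane a x v : v \in val x -> v != 0 -> linear_form a v = 0 ->
  forall w, w \in val x -> linear_form a w = 0.
Proof.
move=> vx v0 av w; rewrite (projective_lineE vx v0) => /vlineP [c ->].
by rewrite linear_formZ av mulr0.
Qed.

(** Numerator and denominator scale alike, so the arbitrary choice of homogeneous coordinates
    cancels. *)
Definition normalized_coord (f : R[i] -> projective_space R[i] m) a k z : R[i] :=
  homogeneous_coords (f z) 0 k / linear_form a (homogeneous_coords (f z)).

(** Near z0, in a chart containing f z0, it is an affine coordinate divided by the form evaluated at
    the affine coordinates. *)
Lemma entire_normalized_coord f a k : holomorphic_curve f ->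
  (forall z, linear_form a (homogeneous_coords (f z)) != 0) ->
  entire (normalized_coord f a k).
Proof.
move=> hf ha z0.
have [i hi] : exists i, homogeneous_coords (f z0) 0 i != 0.
  apply: contrapT => hn; have := homogeneous_coords_neq0 (f z0); move=> /eqP; apply.
  apply/rowP => i; rewrite mxE; apply/eqP/negPn/negP => hi; apply: hn; by exists i.
have near_i := hf z0 i hi.
have [_ der] := nbhs_singleton near_i.
pose g k : R[i]^o -> R[i]^o := affine_coord i k \o f.
pose s : R[i]^o -> R[i]^o := fun z => \sum_l a 0 l * (g l z : R[i]).
have sE z : affine_chart i (f z) ->
    s z = linear_form a (homogeneous_coords (f z)) / homogeneous_coords (f z) 0 i.
  by move=> _; rewrite /s /linear_form mulr_suml; apply: eq_bigr => l _; rewrite mulrA.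
apply: (@near_eq_derivable _ _ _ (fun z => (g k z : R[i]) * (s z : R[i])^-1 : R[i]^o)).
  apply: filterS near_i => z [ch _]; rewrite /normalized_coord sE // /g /= /affine_coord.
  by rewrite invf_div mulrA mulfVK.
have ds : derivable s z0 1.
  rewrite (_ : s = \sum_l (fun z : R[i]^o => a 0 l * (g l z : R[i]) : R[i]^o)).
    apply: derivable_sum => l.
    by apply: (@derivableM _ _ (fun=> a 0 l : R[i]^o) (g l)); [exact: derivable_cst|exact: der].
  by apply/funext => z; rewrite fct_sumE.
apply: (@derivableM _ _ (g k) (fun z => (s z : R[i])^-1 : R[i]^o)); first exact: der.
apply: derivableV => //; rewrite sE //.
by rewrite mulf_neq0 ?invr_neq0.
Qed.

End ProjectiveCurves.

(** * Liouville's theorem and the conclusion *)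

Section Liouville.
Variable R : realType.

Lemma entire_bounded_cst (f : R[i] -> R[i]) (B : R) : entire f ->
  (forall z, normc (f z) <= B) -> forall z, f z = f 0.
Proof.
move=> ef fB z.
have re : Re (f z) = Re (f 0).
  apply: (harmonic_liouville (harmonic_Re ef) (A := B)) => w.
  exact: le_trans (Re_le_normc _) (fB w).
have eg : entire (fun z => - 'i%C * f z).
  move=> w; apply: (@derivableM _ _ (fun=> - 'i%C : R[i]^o) (f : R[i]^o -> R[i]^o)).
    exact: derivable_cst.
  exact: ef.
have ReI w : Re (- 'i%C * f w) = Im (f w) by case: (f w) => u v /=; ring.
have im : Im (f z) = Im (f 0).
  rewrite -!ReI; apply: (harmonic_liouville (harmonic_Re eg) (A := B)) => w.
  rewrite ReI; apply: le_trans (ler_norm _) _; exact: le_trans (normc_Im _) (fB w).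
by apply/eqP; rewrite eq_complex re im !eqxx.
Qed.

(** The inverse of 1 plus the sum of inverses also serves when T is empty. *)
Lemma pos_lower_bound (T : finType) (c : T -> R) : (forall t, 0 < c t) ->
  exists2 d : R, 0 < d & forall t, d <= c t.
Proof.
move=> hc; pose s := \sum_t (c t)^-1.
have s0 : 0 <= s by apply: sumr_ge0 => t _; rewrite invr_ge0 ltW.
exists (s + 1)^-1 => [|t]; first by rewrite invr_gt0 ltr_wpDl.
rewrite -[leRHS]invrK lef_pV2 ?posrE ?invr_gt0 // ?ltr_wpDl //.
rewrite /s (bigD1 t) //= -addrA lerDl addr_ge0 // sumr_ge0 // => t' _.
by rewrite invr_ge0 ltW.
Qed.

End Liouville.

Theorem theorem1 (R : realType) (m n : nat)
    (M : set (projective_space R[i] m)) (hM : zariski_closed M)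
    (D : 'I_(2 * n + 1) -> set (projective_space R[i] m))
    (hD : forall j, divisor_on M (D j))
    (hcap : forall I : {set 'I_(2 * n + 1)},
        #|I| = (n + 1)%N -> \bigcap_(j in [set` I]) D j = set0)
    (f : R[i] -> projective_space R[i] m)
    (hf : holomorphic_curve f)
    (hfM : range f `<=` M)
    (homit : forall j, range f `&` D j = set0) :
  exists x : projective_space R[i] m, forall z : R[i], f z = x.
Proof.
have [S [Shom MS]] := hM.
have /choice [a ha] : forall j, exists a : 'rV[R[i]]_m.+1,
    D j = [set x : projective_space R[i] m | forall v, v \in val x -> linear_form a v = 0] `&` M.
  by move=> j; have [H [a _ ->] ->] := hD j; exists a.
pose hc z := homogeneous_coords (f z).
have hc0 z : hc z != 0 by exact: homogeneous_coords_neq0.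
have hcmem z : hc z \in val (f z) by exact: homogeneous_coords_mem.
have hcS z p : S p -> meval (fun i => hc z 0 i) p = 0.
  move=> Sp; have : M (f z) by apply: hfM; exists z.
  by rewrite MS => /(_ p Sp); apply.
have Lhc j z : linear_form (a j) (hc z) != 0.
  apply/eqP => h0; have : (range f `&` D j) (f z).
    split; first by exists z.
    rewrite ha; split; last by apply: hfM; exists z.
    exact: linear_form_hyperplane (hcmem z) (hc0 z) h0.
  by rewrite homit.
have Sscale p (v : 'rV[R[i]]_m.+1) (c : R[i]) : S p -> meval (fun i => v 0 i) p = 0 ->
    meval (fun i => (c *: v) 0 i) p = 0.
  by move=> /Shom [d hp] pv; rewrite (homogeneous_meval v c hp) pv mulr0.
(* One constant per set of n + 1 divisors; other sets get the dummy value 1. *)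
have /choice [c hcI] : forall I : {set 'I_(2 * n + 1)}, exists c : R, 0 < c /\
    (#|I| = (n + 1)%N -> forall v : 'rV[R[i]]_m.+1,
    (forall p, S p -> meval (fun i => v 0 i) p = 0) -> v != 0 ->
    exists2 j, j \in I & c * norm1 v <= normc (linear_form (a j) v)).
  move=> I; have [cI|nI] := eqVneq #|I| (n + 1)%N; last first.
    by exists 1; split => // cI; rewrite cI eqxx in nI.
  (* A nonzero common zero in the cone over M would span a point of the empty intersection. *)
  have := @cone_lower_bound R m.+1 {j | j \in I} (fun j => a (val j)) S Sscale.
  case.
    move=> v vS vL; apply/eqP; apply: contrapT => /negP v0.
    have dv : \dim <[v]> == 1%N by rewrite dim_vline v0.
    pose x : projective_space R[i] m := exist _ <[v]>%VS dv.
    have vx : v \in val x by exact: memv_line.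
    have : (\bigcap_(j in [set` I]) D j) x.
      move=> j /= jI; rewrite ha; split.
        exact: linear_form_hyperplane vx v0 (vL (exist _ j jI)).
      rewrite MS => p Sp; have [d hp] := Shom p Sp.
      exact: vanishes_atE hp vx v0 (vS p Sp).
    by rewrite hcap.
  move=> c c0 h; exists c; split => // _ v vS v0.
  by have [[j jI] /= hj] := h v vS v0; exists j.
have [c' c'0 hc'] := pos_lower_bound (fun I => (hcI I).1).
have j0 : 'I_(2 * n + 1) by exists 0%N; rewrite addn1.
pose F k := normalized_coord f (a j0) k.
have eF k : entire (F k) by apply: entire_normalized_coord => // z; exact: Lhc.
pose Fv z : 'rV[R[i]]_m.+1 := (linear_form (a j0) (hc z))^-1 *: hc z.
have FvE z k : Fv z 0 k = F k z by rewrite mxE mulrC.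
have Fv0 z : Fv z != 0 by rewrite scaler_eq0 negb_or invr_eq0 Lhc hc0.
have FvS z p : S p -> meval (fun i => Fv z 0 i) p = 0.
  by move=> Sp; apply: Sscale => //; exact: hcS.
pose g j z := linear_form (a j) (Fv z).
have g0 j z : g j z != 0 by rewrite /g linear_formZ mulf_neq0 ?invr_eq0 ?Lhc.
have eg j : entire (g j).
  move=> z; rewrite /g.
  rewrite (_ : (fun z => _) = \sum_l (fun z : R[i]^o => a j 0 l * F l z : R[i]^o)).
    apply: derivable_sum => l.
    apply: (@derivableM _ _ (fun=> a j 0 l : R[i]^o) (F l : R[i]^o -> R[i]^o)).
      exact: derivable_cst.
    exact: eF.
  by apply/funext => w; rewrite fct_sumE; apply: eq_bigr => l _; rewrite FvE.
have gj0 z : g j0 z = 1 by rewrite /g linear_formZ mulVf // Lhc.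
pose u j z := ln (normc (g j z)).
have hu j : is_harmonic (u j) by apply: harmonic_log => // z; exact: g0.
have Fpos z : 0 < norm1 (Fv z).
  rewrite lt_def norm1_ge0 andbT; apply: contraNneq (Fv0 z) => /norm1_eq0 ->.
  by rewrite eqxx.
pose A := \sum_j norm1 (a j) + 1.
have A0 : 0 < A by rewrite ltr_wpDl // sumr_ge0 // => j _; exact: norm1_ge0.
have gA j z : normc (g j z) <= A * norm1 (Fv z).
  apply: le_trans (linear_form_le _ _) _; rewrite ler_wpM2r ?norm1_ge0 //.
  rewrite /A (bigD1 j) //= -addrA lerDl addr_ge0 // sumr_ge0 // => i _.
  exact: norm1_ge0.
(* No form exceeds A times the norm, so those in [big z] are maximal up to the factor A / c'. *)
pose big z := [set j | c' * norm1 (Fv z) <= normc (g j z)]%SET.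
have bigP z : (2 * n + 1 < #|big z| + #|big z|)%N.
  (* More than n exceptions would include n + 1 indices, one of which satisfies the bound [hcI]. *)
  suff : (#|~: big z| <= n)%N.
    by have := cardsC (big z); rewrite card_ord; lia.
  rewrite leqNgt; apply/negP => hlt.
  pose I := [set j in take (n + 1) (enum (~: big z))]%SET.
  have cI : #|I| = (n + 1)%N.
    rewrite cardsE; move/card_uniqP : (take_uniq (n + 1) (enum_uniq (~: big z))) => ->.
    by rewrite size_takel // -cardE addn1.
  have [j] := (hcI I).2 cI (Fv z) (FvS z) (Fv0 z).
  rewrite inE => /mem_take; rewrite mem_enum !inE => /negP jn hj; apply: jn.
  by apply: le_trans hj; rewrite ler_wpM2r ?norm1_ge0.
pose C := ln (A / c').
have maj : majority_dominates u `|C|.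
  move=> z; exists (big z); first by rewrite card_ord bigP.
  move=> k; rewrite inE => hk j; apply: le_trans (ler_norm _).
  rewrite lerBlDr /u /C -lnM ?posrE ?normc_gt0 ?divr_gt0 //.
  rewrite ler_ln ?posrE ?mulr_gt0 ?normc_gt0 ?invr_gt0 //.
  apply: le_trans (gA j z) _; rewrite mulrAC ler_pdivlMr // mulrAC.
  by rewrite -mulrA ler_pM2l.
have [k [B hB]] := majority_dominated (normr_ge0 C) hu maj.
have aux (x y b d : R) : x - y = b -> 0 - y = d -> x = b - d.
  by move=> <- <-; ring.
have u0 w : u j0 w = 0 by rewrite /u gj0 normc1 ln1.
(* Both u j - u k and u j0 - u k = - u k are bounded above, hence constant; subtraction removes u
   k. *)
have ucst j z : u j z = u j 0 - u k 0 - (u j0 0 - u k 0).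
  apply: (aux _ (u k z)).
    exact: (harmonic_liouville (harmonicB (hu j) (hu k)) (fun w => hB w j)).
  rewrite -{1}(u0 z).
  exact: (harmonic_liouville (harmonicB (hu j0) (hu k)) (fun w => hB w j0)).
have gB : exists B' : R, forall j z, normc (g j z) <= B'.
  exists (\sum_j expR (u j 0 - u k 0 - (u j0 0 - u k 0))) => j z.
  rewrite (bigD1 j) //= -(ucst j z) /u lnK ?posrE ?normc_gt0 // lerDl.
  by rewrite sumr_ge0 // => i _; exact: expR_ge0.
have [B' hB'] := gB.
(* [big z] is nonempty, and any of its forms bounds the norm of the whole vector. *)
have FB k' z : normc (F k' z) <= B' / c'.
  have hb : (#|{: 'I_(2 * n + 1)}| < #|big z| + #|big z|)%N by rewrite card_ord bigP.
  have [j] := majority_meet hb hb; rewrite inE => hj _; rewrite ler_pdivlMr // mulrC.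
  apply: le_trans (hB' j z); apply: le_trans hj; rewrite ler_pM2l //.
  by rewrite -FvE normc_le_norm1.
exists (f 0) => z; apply: val_inj.
have Fmem w : Fv w \in val (f w) by rewrite memvZ.
rewrite /= (projective_lineE (Fmem z) (Fv0 z)) (projective_lineE (Fmem 0) (Fv0 0)).
congr <[_]>%VS; apply/rowP => i; rewrite !FvE.
exact: (entire_bounded_cst (eF i) (FB i)).
Qed.
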